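(* Let $V$ be a finite set, $d\geq 0$ an integer, and let $\mathscr{O}$ be an oriented matroid on the set of elements $V$ of rank at most $d$. Suppose that $r\geq\max\{d+1,2\}$, that $U_1,\ldots,U_r\subseteq V$ are pairwise disjoint subsets each of which contains a positive circuit of $\mathscr{O}$, and that $\mathscr{K}$ is a simplicial complex on the ground set $V$ of the form $\mathscr{K}_{12}*U_3*\cdots*U_r$, where $\mathscr{K}_{12}$ is a connected simplicial subcomplex of $U_1*U_2$ with vertex set $U_1\cup U_2$, and the sets $U_i$ are viewed as $0$-dimensional simplicial complexes with vertex set $U_i$. Then there exists a face $\sigma\in\mathscr{K}$ such that $\sigma$ contains a positive circuit of $\mathscr{O}$.
   Context: Simplicial complexes are abstract simplicial complexes. The join of complexes $\mathscr{X},\mathscr{Y}$ on disjoint ground sets is $\mathscr{X}*\mathscr{Y}=\{\sigma\cup\tau:\sigma\in\mathscr{X},\tau\in\mathscr{Y}\}$; a set $U$ viewed as a $0$-dimensional complex has faces $\emptyset$ and $\{u\}$, $u\in U$. Let $E$ be a finite set. A sign vector on $E$ is a function $\Phi\colon E\to\{-,0,+\}$; write $\Phi^{+}=\Phi^{-1}(+)$, $\Phi^{-}=\Phi^{-1}(-)$, $\underline{\Phi}=\Phi^+\cup\Phi^-$ (support), $0$ for the all-zero sign vector, $-\Phi$ for the coordinatewise negation, $(\Phi\circ\Psi)(e)=\Phi(e)$ if $\Phi(e)\ne0$ and $\Psi(e)$ otherwise, and $S(\Phi,\Psi)=(\Phi^+\cap\Psi^-)\cup(\Phi^-\cap\Psi^+)$.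 Sign vectors are ordered coordinatewise by $0<-$, $0<+$ (with $-,+$ incomparable). An oriented matroid $\mathscr{O}$ on the set of elements $E$ is given by a set $\mathscr{L}(\mathscr{O})$ of sign vectors on $E$ (its covectors) such that: $0\in\mathscr{L}(\mathscr{O})$; $-\Phi\in\mathscr{L}(\mathscr{O})$ iff $\Phi\in\mathscr{L}(\mathscr{O})$; $\Phi\circ\Psi\in\mathscr{L}(\mathscr{O})$ for all $\Phi,\Psi\in\mathscr{L}(\mathscr{O})$; and for all $\Pi,\Xi\in\mathscr{L}(\mathscr{O})$ and $v\in\Pi^+\cap\Xi^-$ there is $\Theta\in\mathscr{L}(\mathscr{O})$ with $\Theta(v)=0$ and $\Theta(w)=(\Pi\circ\Xi)(w)$ for all $w\in E-S(\Pi,\Xi)$. Two sign vectors $\Phi,\Psi$ are orthogonal if: there is $v$ with $\Phi(v)=\Psi(v)\neq0$ if and only if there is $w$ with $\Phi(w)=-\Psi(w)\neq0$. A vector of $\mathscr{O}$ is a sign vector orthogonal to every covector; a circuit is a minimal nonzero vector. A sign vector $\Phi$ is positive if $\Phi\neq0$ and $\Phi^-=\emptyset$; a set $U\subseteq E$ contains $\Phi$ if $\underline{\Phi}\subseteq U$. The rank of $\mathscr{O}$ is the usual one: the maximal $k$ for which there is a chain $0<\Phi_1<\dots<\Phi_k$ in $\mathscr{L}(\mathscr{O})$. *)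

(* Defs.v *)
From HB Require Import structures.
From mathcomp Require Import all_boot.

Set Implicit Arguments.
Unset Strict Implicit.
Unset Printing Implicit Defensive.

Inductive sign := Neg | Zero | Pos.

Definition option_of_sign (s : sign) : option bool :=
  match s with Neg => Some false | Zero => None | Pos => Some true end.

Definition sign_of_option (o : option bool) : sign :=
  match o with Some false => Neg | None => Zero | Some true => Pos end.

Lemma option_of_signK : cancel option_of_sign sign_of_option.
Proof. by case. Qed.

HB.instance Definition _ := Finite.copy sign (can_type option_of_signK).

Definition sign_opp (s : sign) : sign :=
  match s with Neg => Pos | Zero => Zero | Pos => Neg end.

Definition sign_le (s t : sign) : bool := (s == Zero) || (s == t).

Notation signvec E := {ffun E -> sign}.

Section SignVectors.
Variable E : finType.
Implicit Types Phi Psi : signvec E.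

Definition sv_zero : signvec E := [ffun => Zero].
Definition sv_opp Phi : signvec E := [ffun e => sign_opp (Phi e)].
Definition sv_comp Phi Psi : signvec E :=
  [ffun e => if Phi e != Zero then Phi e else Psi e].

Definition sv_pos Phi : {set E} := [set e | Phi e == Pos].
Definition sv_neg Phi : {set E} := [set e | Phi e == Neg].
Definition sv_supp Phi : {set E} := sv_pos Phi :|: sv_neg Phi.

Definition sv_sep Phi Psi : {set E} :=
  (sv_pos Phi :&: sv_neg Psi) :|: (sv_neg Phi :&: sv_pos Psi).

Definition sv_le Phi Psi : bool := [forall e, sign_le (Phi e) (Psi e)].
Definition sv_lt Phi Psi : bool := (Phi != Psi) && sv_le Phi Psi.

Definition sv_orthogonal Phi Psi : bool :=
  [exists v, (Phi v == Psi v) && (Phi v != Zero)] ==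
  [exists w, (Phi w == sign_opp (Psi w)) && (Phi w != Zero)].

Definition sv_positive Phi : bool := (Phi != sv_zero) && (sv_neg Phi == set0).

Lemma sv_lt_irr : irreflexive sv_lt.
Proof. by move=> Phi; rewrite /sv_lt eqxx. Qed.

Lemma sv_lt_trans : transitive sv_lt.
Proof.
move=> Psi Phi Xi /andP[ne1 /forallP le1] /andP[_ /forallP le2].
apply/andP; split.
  apply: contra ne1 => /eqP eqXi; apply/eqP/ffunP => e.
  move: (le1 e) (le2 e); rewrite -eqXi /sign_le.
  by case: (Phi e) => //; case: (Psi e).
apply/forallP => e; move: (le1 e) (le2 e); rewrite /sign_le.
by case: (Phi e) => //; case: (Psi e) => //; case: (Xi e).
Qed.

End SignVectors.

Record oriented_matroid (E : finType) := OrientedMatroid {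
  covectors : {set signvec E};
  covector0 : sv_zero E \in covectors;
  covectorN : forall Phi, (sv_opp Phi \in covectors) <-> (Phi \in covectors);
  covector_comp : forall Phi Psi,
    Phi \in covectors -> Psi \in covectors -> sv_comp Phi Psi \in covectors;
  covector_elim : forall Pi Xi v,
    Pi \in covectors -> Xi \in covectors -> v \in sv_pos Pi :&: sv_neg Xi ->
    exists Theta, [/\ Theta \in covectors, Theta v = Zero
      & forall w, w \notin sv_sep Pi Xi -> Theta w = sv_comp Pi Xi w]
}.

Section OrientedMatroids.
Variables (E : finType) (O : oriented_matroid E).

Definition is_vector (Phi : signvec E) : bool :=
  [forall Psi in covectors O, sv_orthogonal Phi Psi].

Definition is_circuit (Phi : signvec E) : bool :=
  [&& is_vector Phi, Phi != sv_zero E &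
    [forall Psi, is_vector Psi && (Psi != sv_zero E) ==> ~~ sv_lt Psi Phi]].

Definition contains_positive_circuit (U : {set E}) : bool :=
  [exists Phi, [&& is_circuit Phi, sv_positive Phi & sv_supp Phi \subset U]].

Definition has_chain (k : nat) : bool :=
  [exists s : k.-tuple (signvec E),
    all (mem (covectors O)) s && path (@sv_lt E) (sv_zero E) s].

Lemma has_chain_ex : exists k, has_chain k.
Proof. by exists 0; apply/existsP; exists [tuple]. Qed.

Lemma has_chain_bound k : has_chain k -> k <= #|signvec E|.
Proof.
case/existsP=> s /andP[_ /path_sorted s_sorted].
have s_uniq := sorted_uniq (@sv_lt_trans E) (@sv_lt_irr E) s_sorted.
by rewrite -(size_tuple s) -(card_uniqP s_uniq) max_card.
Qed.

Definition om_rank : nat := ex_maxn has_chain_ex has_chain_bound.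

End OrientedMatroids.

Section SimplicialComplexes.
Variable V : finType.
Implicit Types K X Y : {set {set V}}.

(* Complexes contain the empty face, and points of V need not be vertices. *)
Definition simplicial_complex K : Prop :=
  set0 \in K /\
  (forall sigma tau : {set V}, sigma \in K -> tau \subset sigma -> tau \in K).

Definition vertex_set K : {set V} := [set v | [set v] \in K].

(* Connectedness of the geometric realization, read off the 1-skeleton;
   a connected complex has at least one vertex. *)
Definition connected_complex K : Prop :=
  vertex_set K != set0 /\
  {in vertex_set K &, forall u v, connect (fun x y => [set x; y] \in K) u v}.

Definition join X Y : {set {set V}} :=
  [set sigma :|: tau | sigma in X, tau in Y].

Definition points (U : {set V}) : {set {set V}} :=
  set0 |: [set [set u] | u in U].

End SimplicialComplexes.

(* Main.v *)
Require Import Defs.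
From mathcomp Require Import all_boot all_algebra.

Set Implicit Arguments.
Unset Strict Implicit.
Unset Printing Implicit Defensive.

Import GRing.Theory.

(** Suppose that no face of [K] contains a positive circuit.  By a Farkas
    argument ([positive_covector]) every face of [K] then lies in the positive
    part of some covector.  Let [D] be the order complex of the poset of all
    covectors; it is a cone with apex the zero covector, and its simplices that
    avoid the apex have at most rank many vertices.  All chains have
    coefficients in the field with two elements and are augmented: the empty
    face is a simplex.  Two chain maps are built from acyclic carriers.

    - From [D] to [K].  For a nonzero covector [Phi] put
      [M Phi = U_1' * U_3' * ... * U_r'] with [U_i' = U_i :\: sv_pos Phi], and
      put [M 0 = K].  A chain of covectors with minimum [Phi] is sent into
      [M Phi].  No [U_i'] is empty, because [U_i] contains a positive circuit
      ([positive_circuit_meets]), so [M Phi] has fillings up to the dimension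
      needed; so does [K], where connectedness of [K12] replaces one more
      color ([fillable_join_bigjoin], [connected_fillable]).

    - From [K] to [D].  A face [t] is sent to chains of covectors that are
      positive somewhere on [t].  These covectors form an acyclic poset
      ([somewhere_positive_acyclic]), since they are a union of cells
      [positive_cell] whose intersections are again such cells, and a cell is
      acyclic by induction on deletions ([positive_cell_acyclic]).

    The composite is an endomorphism of the chains of [D].  If a nonempty
    simplex [s] occurred in its own image, some face [t] would avoid the
    positive part of some [Phi] in [s], whereas every covector in [s] is
    positive somewhere on [t].  Hence only the empty simplex contributes to the
    trace, which is therefore 1.  But the augmented complex of a cone is
    contractible, so that every chain endomorphism of it has trace 0
    ([cone_trace]); this is the Lefschetz fixed point theorem in the only case
    needed ([no_avoiding_carrier]). *)

Notation chain T := {ffun {set T} -> 'F_2}.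

(** * Augmented simplicial chains modulo 2 *)
Section Chains.
Local Open Scope ring_scope.

Lemma F2_addrr (a : 'F_2) : a + a = 0.
Proof. by apply: addrr_pchar2; rewrite pchar_Fp. Qed.

Lemma chain_addrr (T : finType) (c : chain T) : c + c = 0.
Proof. by apply/ffunP => s; rewrite !ffunE F2_addrr. Qed.

Lemma chain_addr_eq0 (T : finType) (c d : chain T) : c + d = 0 -> c = d.
Proof.
move/eqP; rewrite addr_eq0 => /eqP->.
by apply/eqP; rewrite eq_sym -addr_eq0 chain_addrr.
Qed.

(** Off the diagonal the terms cancel in pairs; this is behind both
    [boundaryK] and [face_sumK]. *)
Lemma sum_offdiag (V : zmodType) (hV : forall v : V, v + v = 0)
  (T : finType) (A : {set T}) (G : T -> T -> V) :
  (forall x y, G x y = G y x) ->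
  \sum_(x in A) \sum_(y in A :\ x) G x y = 0.
Proof.
move=> Gsym; elim: {A}#|A| {-2}A (erefl #|A|) => [|n IH] A cA.
  by rewrite (cards0_eq cA) big_set0.
have [a aA] : exists a, a \in A by apply/set0Pn; rewrite -cards_eq0 cA.
have cB : #|A :\ a| = n by move: cA; rewrite (cardsD1 a) aA => -[].
rewrite (big_setD1 a) //=.
have -> : \sum_(x in A :\ a) \sum_(y in A :\ x) G x y =
    \sum_(x in A :\ a) (G a x + \sum_(y in (A :\ a) :\ x) G x y).
  apply: eq_bigr => x /setD1P[xa xA].
  rewrite (big_setD1 a) /=; last by rewrite !inE eq_sym xa.
  by rewrite Gsym setDDl setUC -setDDl.
by rewrite big_split /= addrA hV add0r IH.
Qed.

(** Pairs of a simplex and one of its vertices, indexed by the opposite face. *)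
Lemma sum_faces (V : zmodType) (T : finType) (F : {set T} -> T -> V) :
  \sum_(s : {set T}) \sum_(x in s) F s x =
  \sum_(t : {set T}) \sum_(x | x \notin t) F (x |: t) x.
Proof.
rewrite (exchange_big_dep predT) //= [RHS](exchange_big_dep predT) //=.
apply: eq_bigr => x _.
rewrite (reindex_onto (fun t => x |: t) (fun s => s :\ x)) /=; last first.
  by move=> s xs; rewrite setD1K.
apply: eq_bigl => t; rewrite setU11 /=.
apply/eqP/idP => [<-|xt]; first by rewrite !inE eqxx.
by rewrite setU1K.
Qed.

Section OneType.
Variable T : finType.
Implicit Types (c z : chain T) (X Y : {set {set T}}) (s t : {set T}).

Definition simplex_chain s : chain T := [ffun t => (t == s)%:R].

(** The empty set is a simplex like any other, so this is the boundary of the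
    augmented complex. *)
Definition boundary c : chain T :=
  [ffun t : {set T} => \sum_(x | x \notin t) c (x |: t)].

(** For [g] valued in chains, [boundary (g s) = face_sum g s] says that [g] is a
    chain map at the simplex [s]. *)
Definition face_sum (V : zmodType) (g : {set T} -> V) s : V :=
  \sum_(x in s) g (s :\ x).

Lemma boundaryD c z : boundary (c + z) = boundary c + boundary z.
Proof.
apply/ffunP => t; rewrite !ffunE -big_split /=.
by apply: eq_bigr => x _; rewrite !ffunE.
Qed.

Lemma boundary0 : boundary 0 = 0.
Proof. by apply/ffunP => t; rewrite !ffunE big1 // => x _; rewrite ffunE. Qed.

Lemma boundary_sum (I : Type) (r : seq I) (P : pred I) (F : I -> chain T) :
  boundary (\sum_(i <- r | P i) F i) = \sum_(i <- r | P i) boundary (F i).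
Proof. exact: (big_morph _ boundaryD boundary0). Qed.

Lemma boundaryK c : boundary (boundary c) = 0.
Proof.
apply/ffunP => t; rewrite !ffunE.
rewrite -[RHS](@sum_offdiag _ F2_addrr _ (~: t) (fun x y => c (y |: (x |: t)))).
  apply: eq_big => [x|x xt]; first by rewrite inE.
  by rewrite ffunE; apply: eq_bigl => y; rewrite !inE negb_or.
by move=> x y; rewrite setUCA.
Qed.

Lemma face_sumK (V : zmodType) (hV : forall v : V, v + v = 0)
  (g : {set T} -> V) s : face_sum (face_sum g) s = 0.
Proof.
rewrite /face_sum (@sum_offdiag _ hV _ s (fun x y => g (s :\ x :\ y))) //.
by move=> x y; rewrite !setDDl setUC.
Qed.

Lemma boundary_simplex s : boundary (simplex_chain s) = face_sum simplex_chain s.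
Proof.
apply/ffunP => t; rewrite !ffunE /face_sum sum_ffunE.
rewrite [LHS](bigID (mem s)) /= [X in _ + X]big1 ?addr0; last first.
  by move=> x /andP[_ xs]; rewrite ffunE (_ : _ == _ = false) //; apply: contraNF xs => /eqP<-; rewrite setU11.
rewrite [RHS](bigID (mem t)) /= [X in _ = X + _]big1 ?add0r; last first.
  move=> x /andP[xs xt]; rewrite ffunE (_ : _ == _ = false) //.
  by apply: contraTF xt => /eqP->; rewrite !inE eqxx.
apply: eq_big => [x|x /andP[xt xs]]; first by rewrite andbC.
rewrite !ffunE; congr (_%:R); congr nat_of_bool; apply/eqP/eqP => [<-|->].
  by rewrite setU1K.
by rewrite setD1K.
Qed.

(** The degree is the number of vertices, one more than the dimension. *)
Definition chain_in X n c : Prop := forall t, c t != 0 -> t \in X /\ #|t| = n.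

Lemma chain_in0 X n : chain_in X n 0.
Proof. by move=> t; rewrite ffunE eqxx. Qed.

Lemma chain_inD X n c z : chain_in X n c -> chain_in X n z -> chain_in X n (c + z).
Proof.
move=> hc hz t; rewrite ffunE => ne.
have [ct0|/hc//] := eqVneq (c t) 0.
by apply: hz; move: ne; rewrite ct0 add0r.
Qed.

Lemma chain_in_sum X n (I : Type) (r : seq I) (P : pred I) (F : I -> chain T) :
  (forall i, P i -> chain_in X n (F i)) -> chain_in X n (\sum_(i <- r | P i) F i).
Proof.
by move=> h; elim/big_ind: _ => //; [exact: chain_in0|exact: chain_inD].
Qed.

Lemma chain_inS X Y n c : X \subset Y -> chain_in X n c -> chain_in Y n c.
Proof. by move=> sXY h t /h[/(subsetP sXY)]. Qed.

Lemma chain_in_simplex X s : s \in X -> chain_in X #|s| (simplex_chain s).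
Proof. by move=> sX t; rewrite ffunE; have [->|_] := eqVneq t s; rewrite ?eqxx. Qed.

Lemma chain_in_boundary X n c : simplicial_complex X ->
  chain_in X n.+1 c -> chain_in X n (boundary c).
Proof.
move=> [_ Xdown] h t; rewrite ffunE => ne.
have [x xt cne] : exists2 x, x \notin t & c (x |: t) != 0.
  apply/exists_inP; apply: contraNT ne => /exists_inPn h0.
  by rewrite big1 // => x /h0; rewrite negbK => /eqP.
have [/Xdown tX] := h _ cne.
rewrite cardsU1 xt => -[<-]; split => //; apply: tX; exact: subsetUr.
Qed.

(** Vanishing of the reduced homology in dimension [n - 1]; in particular
    [fillable X 0] says that [X] has a vertex when the empty set is a face. *)
Definition fillable X n : Prop :=
  forall z, chain_in X n z -> boundary z = 0 ->
  exists2 y, chain_in X n.+1 y & boundary y = z.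

Definition acyclic X : Prop := forall n, fillable X n.

(** Filling: the cone with apex [a] over the part of the cycle that avoids [a]. *)
Lemma acyclic_cone X a : (forall s, s \in X -> a |: s \in X) ->
  acyclic X.
Proof.
move=> Xa n z zin bz0.
exists [ffun t : {set T} => if a \in t then z (t :\ a) else 0].
  move=> t; rewrite ffunE; case: ifP => [at_|]; last by rewrite eqxx.
  move/zin => [tX ct]; rewrite -(setD1K at_); split; first exact: Xa.
  by rewrite cardsU1 !inE eqxx /= ct.
apply/ffunP => t; rewrite !ffunE; have [at_|at_] := boolP (a \in t).
  have := congr1 (fun c : chain T => c (t :\ a)) bz0; rewrite !ffunE.
  rewrite (bigD1 a) /=; last by rewrite !inE eqxx.
  rewrite setD1K // => /eqP; rewrite addr_eq0 => /eqP->.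
  apply/eqP; rewrite -addr_eq0; apply/eqP.
  rewrite -[RHS](F2_addrr (\sum_(x | x \notin t) z (x |: t :\ a))).
  congr (_ + _).
    apply: eq_bigr => x xt; rewrite ffunE !inE at_ orbT.
    congr (z _); rewrite setDUl; congr (_ :|: _).
    by apply/setDidPl; rewrite disjoint_sym disjoints1 inE; apply: contraNneq xt => <-.
  apply: eq_bigl => x; rewrite !inE negb_and negbK.
  by case: eqVneq => [->|_]; rewrite ?at_ ?andbF ?andbT.
rewrite (bigD1 a) //= big1 ?addr0 => [|x /andP[xt xa]].
  by rewrite ffunE setU11 setU1K.
by rewrite ffunE !inE eq_sym (negPf xa) (negPf at_).
Qed.

(** Mayer-Vietoris: cut the cycle into a part in [X] and a part in [Y], and
    correct both by a filling in the intersection of their common boundary. *)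
Lemma fillable_union X Y n : simplicial_complex X -> simplicial_complex Y ->
  fillable X n -> fillable Y n -> (0 < n -> fillable (X :&: Y) n.-1)%N ->
  fillable (X :|: Y) n.
Proof.
move=> cX cY fX fY fXY z zin bz.
pose z1 : chain T := [ffun t => if t \in X then z t else 0].
pose z2 : chain T := [ffun t => if t \in X then 0 else z t].
have zE : z = z1 + z2.
  by apply/ffunP => t; rewrite !ffunE; case: ifP; rewrite ?addr0 ?add0r.
have z1in : chain_in X n z1.
  move=> t; rewrite ffunE; case: ifP => [tX /zin[]|_] //; by rewrite eqxx.
have z2in : chain_in Y n z2.
  move=> t; rewrite ffunE; case: ifP => [|tX /zin[]]; first by rewrite eqxx.
  by rewrite inE tX.
have bz12 : boundary z1 = boundary z2.
  by apply: chain_addr_eq0; rewrite -boundaryD -zE.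
have [w win bw] : exists2 w, chain_in (X :&: Y) n w & boundary w = boundary z1.
  case: n => [|n] in fX fY fXY zin z1in z2in *.
    exists 0; first exact: chain_in0.
    rewrite boundary0; apply/ffunP => t; rewrite !ffunE big1 // => x xt.
    apply/eqP; apply: contraNT xt => /z1in[_ /eqP].
    by rewrite cardsU1 addn_eq0 eqb0 negbK => /andP[].
  apply: fXY => //; last exact: boundaryK.
  have h1 := chain_in_boundary cX z1in.
  have := chain_in_boundary cY z2in; rewrite -bz12 => h2 t ne.
  by have [tX ?] := h1 t ne; have [tY _] := h2 t ne; rewrite inE tX.
have wX : chain_in X n w by apply: chain_inS win; apply: subsetIl.
have wY : chain_in Y n w by apply: chain_inS win; apply: subsetIr.
have [|y1 y1in by1] := fX (z1 + w) (chain_inD z1in wX).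
  by rewrite boundaryD bw chain_addrr.
have [|y2 y2in by2] := fY (z2 + w) (chain_inD z2in wY).
  by rewrite boundaryD bw bz12 chain_addrr.
exists (y1 + y2).
  by apply: chain_inD; [apply: chain_inS y1in|apply: chain_inS y2in]; rewrite ?subsetUl ?subsetUr.
by rewrite boundaryD by1 by2 addrACA chain_addrr addr0.
Qed.

End OneType.

Definition linear_ext (T S : finType) (g : {set T} -> chain S) (c : chain T) : chain S :=
  [ffun t => \sum_(s : {set T}) c s * g s t].

Section Linear.
Variables T S : finType.
Implicit Types (g : {set T} -> chain S) (c z : chain T).

Lemma linear_extD g c z : linear_ext g (c + z) = linear_ext g c + linear_ext g z.
Proof.
apply/ffunP => t; rewrite !ffunE -big_split.
by apply: eq_bigr => s _; rewrite ffunE mulrDl.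
Qed.

Lemma linear_ext0 g : linear_ext g 0 = 0.
Proof. by apply/ffunP => t; rewrite !ffunE big1 // => s _; rewrite ffunE mul0r. Qed.

Lemma linear_ext_sum g (I : Type) (r : seq I) (P : pred I) (F : I -> chain T) :
  linear_ext g (\sum_(i <- r | P i) F i) = \sum_(i <- r | P i) linear_ext g (F i).
Proof. exact: (big_morph _ (linear_extD g) (linear_ext0 g)). Qed.

Lemma linear_ext_fun g h c :
  linear_ext (fun s => g s + h s) c = linear_ext g c + linear_ext h c.
Proof.
apply/ffunP => t; rewrite !ffunE -big_split.
by apply: eq_bigr => s _; rewrite ffunE mulrDr.
Qed.

Lemma linear_ext_simplex g s : linear_ext g (simplex_chain s) = g s.
Proof.
apply/ffunP => t; rewrite ffunE (bigD1 s) //= ffunE eqxx mul1r big1 ?addr0 //.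
by move=> u us; rewrite ffunE (negPf us) mul0r.
Qed.

Lemma eq_linear_ext g h c : (forall s, c s != 0 -> g s = h s) ->
  linear_ext g c = linear_ext h c.
Proof.
move=> gh; apply/ffunP => t; rewrite !ffunE; apply: eq_bigr => s _.
by have [->|/gh->//] := eqVneq (c s) 0; rewrite !mul0r.
Qed.

(** The boundary operator and [face_sum] are adjoint. *)
Lemma linear_ext_face_sum g c :
  linear_ext (face_sum g) c = linear_ext g (boundary c).
Proof.
apply/ffunP => t; rewrite !ffunE.
under eq_bigr => s _ do rewrite /face_sum sum_ffunE mulr_sumr.
rewrite (sum_faces (fun s x => c s * g (s :\ x) t)).
apply: eq_bigr => s _; rewrite ffunE mulr_suml.
by apply: eq_bigr => x xs; rewrite setU1K.
Qed.

Lemma boundary_linear_ext g c :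
  boundary (linear_ext g c) = linear_ext (fun s => boundary (g s)) c.
Proof.
apply/ffunP => t; rewrite !ffunE.
under eq_bigr => x _ do rewrite ffunE.
rewrite exchange_big; apply: eq_bigr => s _ /=.
by rewrite ffunE mulr_sumr.
Qed.

Lemma chain_in_linear_ext (X : {set {set S}}) n g c :
  (forall s, c s != 0 -> chain_in X n (g s)) -> chain_in X n (linear_ext g c).
Proof.
move=> h t; rewrite ffunE => ne.
have /existsP[s] : [exists s, c s * g s t != 0].
  apply: contraNT ne => /existsPn h0; rewrite big1 // => s _.
  by apply/eqP; rewrite -[_ == _]negbK h0.
by rewrite mulf_eq0 negb_or => /andP[/h hs /hs].
Qed.

End Linear.

Lemma linear_ext_id (T : finType) (c : chain T) :
  linear_ext (@simplex_chain T) c = c.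
Proof.
apply/ffunP => t; rewrite ffunE (bigD1 t) //= ffunE eqxx mulr1 big1 ?addr0 //.
by move=> u us; rewrite ffunE eq_sym (negPf us) mulr0.
Qed.

End Chains.

(** * Acyclic carriers and traces *)
Section Carriers.
Local Open Scope ring_scope.

(** One step of the acyclic carrier method, by induction on the size of the
    simplices: [r s + face_sum g s] is a cycle in [C s] and is filled there.
    With shift [e = 0] and [r = 0] it produces chain maps; with [e = 1] and [r]
    the sum of two chain maps it produces homotopies between them. *)
Lemma carrier_extension (T S : finType) (A : {set {set T}})
  (C : {set T} -> {set {set S}}) (e : nat) (r : {set T} -> chain S) (g0 : chain S) :
  simplicial_complex A ->
  (forall s t : {set T}, s \in A -> t \subset s -> C t \subset C s) ->
  (forall s, s \in A -> s != set0 -> fillable (C s) (#|s|.-1 + e)%N) ->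
  (forall s, s \in A -> s != set0 -> chain_in (C s) (#|s|.-1 + e)%N (r s)) ->
  (forall s, s \in A -> boundary (r s) = face_sum r s) ->
  chain_in (C set0) e g0 -> boundary g0 = r set0 ->
  exists2 g : {set T} -> chain S, g set0 = g0 &
    forall s, s \in A ->
      chain_in (C s) (#|s| + e)%N (g s) /\ boundary (g s) = r s + face_sum g s.
Proof.
move=> [A0 Adown] Cmono Cfill rin rbd g0in g0bd.
suff H k : exists2 g : {set T} -> chain S, g set0 = g0 &
    forall s, s \in A -> (#|s| <= k)%N ->
      chain_in (C s) (#|s| + e)%N (g s) /\ boundary (g s) = r s + face_sum g s.
  by have [g gs0 hg] := H #|T|; exists g => // s sA; apply: hg => //; apply: max_card.
elim: k => [|k [g gs0 hg]].
  exists (fun=> g0) => // s _; rewrite leqn0 cards_eq0 => /eqP->.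
  by rewrite cards0 /face_sum big_set0 addr0.
have face_small (s : {set T}) x : (#|s| <= k.+1)%N -> x \in s -> (#|s :\ x| <= k)%N.
  by rewrite (cardsD1 x) => + xs; rewrite xs.
have [h hh] : exists h : {set T} -> chain S, forall s : {set T},
    ((#|s| <= k)%N -> h s = g s) /\
    (s \in A -> #|s| = k.+1 -> chain_in (C s) (#|s| + e)%N (h s) /\
       boundary (h s) = r s + face_sum g s).
  apply: (@fin_all_exists _ (fun=> chain S) (fun (s : {set T}) (y : chain S) =>
    ((#|s| <= k)%N -> y = g s) /\
    (s \in A -> #|s| = k.+1 -> chain_in (C s) (#|s| + e)%N y /\
       boundary y = r s + face_sum g s))) => s.
  have [sk|sk] := leqP #|s| k; first by exists (g s); split=> // _ cs; rewrite cs ltnn in sk.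
  (* Outside the simplices of [A] with [k + 1] vertices any value will do. *)
  have [/andP[sA /eqP cs]|nsA] := boolP ((s \in A) && (#|s| == k.+1)); last first.
    exists 0; split=> // sA cs.
    by rewrite sA cs eqxx in nsA.
  have sn0 : s != set0 by rewrite -cards_eq0 cs.
  have faceA x : x \in s -> s :\ x \in A by move=> _; apply: Adown sA _; apply: subD1set.
  have [||y yin yb] := Cfill s sA sn0 (r s + face_sum g s).
  - apply: chain_inD; first exact: rin.
    apply: chain_in_sum => x xs; have [] := hg _ (faceA x xs).
      by apply: face_small xs; rewrite cs.
    rewrite (cardsD1 x s) xs /= => + _; apply: chain_inS.
    by apply: Cmono => //; apply: subD1set.
  - rewrite boundaryD boundary_sum rbd //.
    rewrite (eq_bigr (fun x => r (s :\ x) + face_sum g (s :\ x))).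
      by rewrite big_split addrA chain_addrr add0r; apply: face_sumK; apply: chain_addrr.
    move=> x xs; have [] // := hg _ (faceA x xs).
    by apply: face_small xs; rewrite cs.
  by exists y; split=> // _ _; split=> //; move: yin; rewrite -addSn cs.
have hg' (s : {set T}) : (#|s| <= k.+1)%N -> face_sum h s = face_sum g s.
  by move=> sk; apply: eq_bigr => x xs; have [-> //] := hh (s :\ x); apply: face_small xs.
exists h; first by have [-> //] := hh set0; rewrite cards0.
move=> s sA sk; rewrite hg' //; have [h1 h2] := hh s.
move: sk; rewrite leq_eqVlt => /orP[/eqP cs|sk]; first exact: h2.
by rewrite h1 //; apply: hg.
Qed.

Definition carried (T S : finType) (A : {set {set T}})
    (C : {set T} -> {set {set S}}) (g : {set T} -> chain S) : Prop :=
  g set0 = simplex_chain set0 /\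
  forall s, s \in A -> chain_in (C s) #|s| (g s) /\ boundary (g s) = face_sum g s.

Lemma carrier_chain_map (T S : finType) (A : {set {set T}})
  (C : {set T} -> {set {set S}}) :
  simplicial_complex A ->
  (forall s t : {set T}, s \in A -> t \subset s -> C t \subset C s) ->
  set0 \in C set0 ->
  (forall s, s \in A -> s != set0 -> fillable (C s) #|s|.-1) ->
  exists g, carried A C g.
Proof.
move=> cA Cmono C0 Cfill.
have [|||||g g0 hg] := @carrier_extension T S A C 0%N (fun=> 0) (simplex_chain set0) cA Cmono.
- by move=> s; rewrite addn0; apply: Cfill.
- by move=> s _ _; apply: chain_in0.
- by move=> s _; rewrite boundary0 /face_sum big1.
- by rewrite -[X in chain_in _ X](cards0 S); apply: chain_in_simplex.
- by rewrite boundary_simplex /face_sum big_set0.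
by exists g; split=> // s /hg; rewrite addn0 add0r.
Qed.

Lemma carrier_homotopy (T S : finType) (A : {set {set T}})
  (C : {set T} -> {set {set S}}) (f g : {set T} -> chain S) :
  simplicial_complex A ->
  (forall s t : {set T}, s \in A -> t \subset s -> C t \subset C s) ->
  (forall s, s \in A -> s != set0 -> acyclic (C s)) ->
  carried A C f -> carried A C g ->
  exists h : {set T} -> chain S, forall s, s \in A ->
    chain_in (C s) #|s|.+1 (h s) /\ boundary (h s) = f s + g s + face_sum h s.
Proof.
move=> cA Cmono Cac [f0 hf] [g0 hg].
have [|||||h h0 hh] :=
  @carrier_extension T S A C 1%N (fun s => f s + g s) 0 cA Cmono.
- by move=> s sA sn0; apply: Cac.
- move=> s sA sn0; rewrite addn1 prednK ?card_gt0 //.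
  by apply: chain_inD; [have [] := hf s sA|have [] := hg s sA].
- move=> s sA; rewrite boundaryD /face_sum big_split /=.
  by congr (_ + _); [have [] := hf s sA|have [] := hg s sA].
- exact: chain_in0.
- by rewrite boundary0 f0 g0 chain_addrr.
by exists h => s /hh; rewrite addn1.
Qed.

Lemma carried_linear_ext (T S : finType) (A : {set {set T}})
  (C : {set T} -> {set {set S}}) (g : {set T} -> chain S) (X : {set {set T}})
  (Y : {set {set S}}) n c :
  carried A C g -> X \subset A -> (forall s, s \in X -> C s \subset Y) ->
  chain_in X n c ->
  chain_in Y n (linear_ext g c) /\
  boundary (linear_ext g c) = linear_ext g (boundary c).
Proof.
move=> [_ hg] /subsetP XA XY cin; split.
  apply: chain_in_linear_ext => s /cin[sX <-].
  by have [+ _] := hg s (XA _ sX); apply: chain_inS; apply: XY.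
rewrite boundary_linear_ext -linear_ext_face_sum.
by apply: eq_linear_ext => s /cin[/XA/hg[]].
Qed.

(** The carriers [C] and [D] give chain maps from [A] to [B] and back, and [H]
    carries a homotopy from the composite to the identity; so a cycle of [A] is
    homologous to one that comes from the acyclic complex [B]. *)
Lemma acyclic_transfer (T S : finType) (A : {set {set T}}) (B : {set {set S}})
  (C : {set T} -> {set {set S}}) (D : {set S} -> {set {set T}})
  (H : {set T} -> {set {set T}}) :
  simplicial_complex A -> simplicial_complex B -> acyclic B ->
  (forall s t : {set T}, s \in A -> t \subset s -> C t \subset C s) ->
  (forall s, s \in A -> s != set0 -> acyclic (C s)) ->
  (forall s, s \in A -> set0 \in C s /\ C s \subset B) ->
  (forall s t : {set S}, s \in B -> t \subset s -> D t \subset D s) ->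
  (forall s, s \in B -> s != set0 -> acyclic (D s)) ->
  (forall s, s \in B -> set0 \in D s /\ D s \subset A) ->
  (forall s t : {set T}, s \in A -> t \subset s -> H t \subset H s) ->
  (forall s, s \in A -> s != set0 -> acyclic (H s)) ->
  (forall s, s \in A -> s \in H s /\ H s \subset A) ->
  (forall (s : {set T}) (t : {set S}), s \in A -> t \in C s -> D t \subset H s) ->
  acyclic A.
Proof.
move=> cA cB acB Cm Ca Cs Dm Da Ds Hm Ha Hs CDH.
have [A0 _] := cA; have [B0 _] := cB.
have [|f hf] := carrier_chain_map cA Cm (proj1 (Cs _ A0)).
  by move=> s sA sn0; apply: Ca.
have [|g hg] := carrier_chain_map cB Dm (proj1 (Ds _ B0)).
  by move=> s sA sn0; apply: Da.
pose gf s := linear_ext g (f s).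
have fin s : s \in A -> chain_in (C s) #|s| (f s) by move/(proj2 hf) => [].
have [h hh] : exists h : {set T} -> chain T, forall s, s \in A ->
    chain_in (H s) #|s|.+1 (h s) /\
    boundary (h s) = simplex_chain s + gf s + face_sum h s.
  apply: (carrier_homotopy cA Hm Ha).
    split=> // s sA; rewrite boundary_simplex; split=> //.
    by apply: chain_in_simplex; have [] := Hs s sA.
  split; first by rewrite /gf (proj1 hf) linear_ext_simplex (proj1 hg).
  move=> s sA.
  have [gin ->] :=
    carried_linear_ext hg (proj2 (Cs s sA)) (fun t => CDH s t sA) (fin s sA).
  split=> //; have [_ ->] := proj2 hf s sA.
  by rewrite linear_ext_sum.
move=> n z zin bz.
have [fzin fzb] : chain_in B n (linear_ext f z) /\ _ :=
  carried_linear_ext hf (subxx A) (fun s sA => proj2 (Cs s sA)) zin.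
have [|y yin yb] := acB n _ fzin; first by rewrite fzb bz linear_ext0.
have [gyin gyb] : chain_in A n.+1 (linear_ext g y) /\ _ :=
  carried_linear_ext hg (subxx B) (fun s sB => proj2 (Ds s sB)) yin.
exists (linear_ext h z + linear_ext g y).
  apply: chain_inD => //; apply: chain_in_linear_ext => s /zin[sA <-].
  by have [+ _] := hh s sA; apply: chain_inS; have [] := Hs s sA.
rewrite boundaryD boundary_linear_ext gyb yb.
rewrite (@eq_linear_ext _ _ _ (fun s => simplex_chain s + gf s + face_sum h s)); last first.
  by move=> s /zin[/hh[]].
rewrite !linear_ext_fun linear_ext_face_sum bz linear_ext0 addr0 linear_ext_id.
have -> : linear_ext gf z = linear_ext g (linear_ext f z).
  apply/ffunP => t; rewrite !ffunE.
  under eq_bigr => s _ do rewrite ffunE mulr_sumr.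
  rewrite exchange_big; apply: eq_bigr => u _; rewrite ffunE mulr_suml.
  by apply: eq_bigr => s _; rewrite mulrA.
by rewrite -addrA chain_addrr addr0.
Qed.

(** For [s] avoiding the apex [a], the chain map equation at [a |: s] expresses
    [f s] through [f (a |: s)] and the [f (a |: (s :\ x))].  In the coefficient at
    [s], the summand for the added vertex [a] is the diagonal entry at [a |: s];
    the others cancel when summed over all [s], pairing the face [s] and added
    vertex [x] with the simplex [x |: s] and removed vertex [x]. *)
Lemma cone_trace (T : finType) (A : {set {set T}}) (a : T) (f : {set T} -> chain T) :
  simplicial_complex A -> (forall s, s \in A -> a |: s \in A) ->
  (forall s, s \in A -> boundary (f s) = face_sum f s) ->
  (forall s t : {set T}, s \in A -> f s t != 0 -> t \in A) ->
  \sum_(s in A) f s s = 0.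
Proof.
move=> [_ Adown] Aa fb fA.
have Aa' s : (a |: s \in A) = (s \in A).
  by apply/idP/idP => [/Adown|/Aa //]; apply; apply: subsetUr.
rewrite (bigID (fun s : {set T} => a \in s)) /=.
rewrite [X in X + _](_ : _ = \sum_(s in A | a \notin s) f (a |: s) (a |: s)); last first.
  rewrite (reindex_onto (fun s => a |: s) (fun s => s :\ a)) /=; last first.
    by move=> s /andP[_ as_]; rewrite setD1K.
  apply: eq_bigl => s; rewrite Aa' setU11 andbT; congr (_ && _).
  by apply/eqP/idP => [<-|as_]; [rewrite !inE eqxx|rewrite setU1K].
(* The entry that occurs once from the face [s] and once from [x |: s]. *)
pose G s x := f (a |: s) (x |: s).
have fE (s : {set T}) : s \in A -> a \notin s -> f s s =
    G s a + \sum_(x | (x \notin s) && (x != a)) G s x + \sum_(x in s) f (a |: (s :\ x)) s.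
  move=> sA as_; have /ffunP/(_ s) := fb _ (Aa s sA).
  rewrite ffunE /face_sum (big_setU1 _ as_) /= ffunE sum_ffunE setU1K //.
  rewrite (bigD1 a) //= => e; apply/esym; rewrite /G e -addrA.
  rewrite (eq_bigr (fun x => f (a |: (s :\ x)) s)); last first.
    by move=> x xs; congr (f _ _); rewrite setDUl; congr (_ :|: _); apply/setDidPl;
       rewrite disjoint_sym disjoints1 inE; apply: contraNneq as_ => <-.
  by rewrite F2_addrr addr0.
rewrite (eq_bigr _ (fun s hs => fE s (proj1 (andP hs)) (proj2 (andP hs)))).
rewrite !big_split /= !addrA F2_addrr add0r.
set X := \sum_(s in A | _) _; rewrite -[RHS](F2_addrr X); congr (_ + _).
rewrite /X.
rewrite big_mkcond (eq_bigr (fun s : {set T} => \sum_(x in s)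
   (if (s \in A) && (a \notin s) then f (a |: (s :\ x)) s else 0))); last first.
  by move=> s _; case: ifP => // _; rewrite big1.
rewrite (sum_faces (fun s x => if (s \in A) && (a \notin s) then f (a |: (s :\ x)) s else 0)).
rewrite [RHS]big_mkcond; apply: eq_bigr => s _.
transitivity (\sum_(x | x \notin s)
    if (x |: s \in A) && (a \notin x |: s) then G s x else 0).
  by apply: eq_bigr => x xs; rewrite setU1K.
case: ifP => [/andP[sA as_]|nsA]; last first.
  rewrite big1 // => x _; case: ifP => // /andP[xsA]; rewrite !inE negb_or => /andP[_ as_].
  by rewrite as_ (Adown _ _ xsA (subsetUr _ _)) in nsA.
rewrite [RHS]big_mkcondr; apply: eq_bigr => x xs.
rewrite !inE negb_or as_ andbT (eq_sym a).
have [xsA|nxsA] //= := boolP (x |: s \in A).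
case: ifP => // _; apply/esym/eqP; apply: contraNT nxsA => ne.
exact: (fA _ _ (Aa _ sA) ne).
Qed.

End Carriers.

(** * Order complexes and the fiber lemma *)
Section OrderComplex.
Variables (T : finType) (le : rel T).
Implicit Types (P Q s t : {set T}).

Definition order_complex P : {set {set T}} :=
  [set s : {set T} | (s \subset P) && [forall x in s, forall y in s, le x y || le y x]].

Lemma order_complexP P s :
  reflect (s \subset P /\ {in s &, forall x y, le x y || le y x}) (s \in order_complex P).
Proof.
rewrite inE; apply: (iffP andP) => -[sP].
  by move=> /forall_inP h; split=> // x y /h/forall_inP; apply.
by move=> h; split=> //; apply/forall_inP => x xs; apply/forall_inP => y ys; apply: h.
Qed.

Lemma order_complex_simplicial P : simplicial_complex (order_complex P).
Proof.
split; first by apply/order_complexP; split; [exact: sub0set|move=> x y; rewrite inE].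
move=> s t /order_complexP[sP h] ts; apply/order_complexP.
split; first exact: subset_trans sP.
by move=> x y /(subsetP ts) xs /(subsetP ts); apply: h.
Qed.

Lemma order_complexS P Q : P \subset Q -> order_complex P \subset order_complex Q.
Proof.
move=> PQ; apply/subsetP => s /order_complexP[sP h]; apply/order_complexP.
by split=> //; apply: subset_trans PQ.
Qed.

Lemma order_complexI P Q : order_complex (P :&: Q) = order_complex P :&: order_complex Q.
Proof. by apply/setP => s; rewrite !inE subsetI andbACA andbb. Qed.

Hypotheses (le_refl : reflexive le) (le_trans : transitive le).

Lemma order_complex_cone P a : a \in P -> {in P, forall x, le a x} ->
  acyclic (order_complex P).
Proof.
move=> aP amin; apply: (@acyclic_cone _ _ a) => s /order_complexP[/subsetP sP h].
apply/order_complexP; split.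
  by apply/subsetP => x /setU1P[->|/sP].
move=> x y /setU1P[->|xs] /setU1P[->|ys]; rewrite ?le_refl //.
- by rewrite amin ?sP.
- by rewrite (amin x) ?sP // orbT.
exact: h.
Qed.

Lemma chain_min P s : s \in order_complex P -> s != set0 ->
  exists2 m, m \in s & {in s, forall x, le m x}.
Proof.
elim: {s}#|s| {-2}s (erefl #|s|) => [|n IH] s cs sP; first by rewrite -cards_eq0 cs.
case/set0Pn => a as_.
have [s0|sn0] := eqVneq (s :\ a) set0.
  exists a => // x xs; have : x \in a |: (s :\ a) by rewrite setD1K.
  by rewrite s0 setU0 => /set1P->.
have [_ /(_ _ _ sP (subD1set s a)) s'P] := order_complex_simplicial P.
have [|m ms mmin] := IH _ _ s'P sn0; first by move: cs; rewrite (cardsD1 a) as_ => -[].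
have {}ms : m \in s by case/setD1P: ms.
have mmin' x : x \in s -> x != a -> le m x by move=> xs xa; apply: mmin; rewrite !inE xa.
have [_ /(_ a m as_ ms)/orP[am|ma]] := order_complexP _ _ sP.
  exists a => // x xs; have [->//|xa] := eqVneq x a.
  by apply: le_trans am _; apply: mmin'.
by exists m => // x xs; have [->//|xa] := eqVneq x a; apply: mmin'.
Qed.

(** A chain lies in any upper set that contains its minimum. *)
Lemma order_complexU P Q :
  {in P, forall x y, y \in P :|: Q -> le x y -> y \in P} ->
  {in Q, forall x y, y \in P :|: Q -> le x y -> y \in Q} ->
  order_complex (P :|: Q) = order_complex P :|: order_complex Q.
Proof.
move=> Pup Qup; apply/eqP; rewrite eqEsubset subUset !order_complexS ?subsetUl ?subsetUr //.
rewrite !andbT; apply/subsetP => s sPQ.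
have [/subsetP sub cmp] := order_complexP _ _ sPQ.
have [->|sn0] := eqVneq s set0.
  by rewrite inE; have [-> _] := order_complex_simplicial P.
have [m ms mmin] := chain_min sPQ sn0.
rewrite inE; apply/orP; case/setUP: (sub m ms) => mPQ; [left|right];
  apply/order_complexP; split=> //; apply/subsetP => x xs.
  by apply: Pup mPQ _ (sub x xs) (mmin x xs).
by apply: Qup mPQ _ (sub x xs) (mmin x xs).
Qed.

End OrderComplex.

Lemma order_complex_opp (T : finType) (le : rel T) (P : {set T}) :
  order_complex (fun x y => le y x) P = order_complex le P.
Proof.
apply/setP => s; rewrite !inE; congr (_ && _).
by apply: eq_forallb => x; congr (_ ==> _); apply: eq_forallb => y; rewrite orbC.
Qed.

(** The homological form of Quillen's fiber lemma.  A chain [s] goes to the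
    elements of [Q] above its image, which form a cone; a chain of [Q] goes back
    to the fiber over the elements above its minimum, and this fiber also
    carries the homotopy. *)
Lemma quillen_fiber (T S : finType) (le : rel T) (le' : rel S) (f : T -> S)
  (P : {set T}) (Q : {set S}) :
  reflexive le -> transitive le -> reflexive le' -> transitive le' ->
  {in P &, forall x y, le x y -> le' (f x) (f y)} ->
  {in P, forall x, f x \in Q} ->
  {in Q, forall q, acyclic (order_complex le [set x in P | le' q (f x)])} ->
  acyclic (order_complex le' Q) -> acyclic (order_complex le P).
Proof.
move=> ler let_ ler' let' fmono fPQ fib Qac.
pose up (s : {set T}) := [set q in Q | [exists x in s, le' (f x) q]].
pose over (t : {set S}) := [set x in P | [exists q in t, le' q (f x)]].
have over_min (t : {set S}) m : m \in t -> {in t, forall q, le' m q} ->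
    over t = [set x in P | le' m (f x)].
  move=> mt mmin; apply/setP => x; rewrite !inE; congr (_ && _).
  apply/exists_inP/idP => [[q qt qx]|mx]; last by exists m.
  exact: let' (mmin q qt) qx.
have over_acyclic t : t \in order_complex le' Q -> t != set0 ->
    acyclic (order_complex le (over t)).
  move=> tQ tn0; have [m mt mmin] := chain_min ler' let' tQ tn0.
  have [/subsetP sub _] := order_complexP _ _ _ tQ.
  by rewrite (over_min t m) //; apply: fib; apply: sub.
have im_chain s : s \in order_complex le P -> f @: s \in order_complex le' Q.
  move=> /order_complexP[/subsetP sP cmp]; apply/order_complexP; split.
    by apply/subsetP => _ /imsetP[x xs ->]; apply: fPQ; apply: sP.
  move=> _ _ /imsetP[x xs ->] /imsetP[y ys ->].
  by case/orP: (cmp x y xs ys) => /fmono->; rewrite ?orbT ?sP.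
have overS (t t' : {set S}) : t' \subset t -> over t' \subset over t.
  move=> /subsetP tt'; apply/subsetP => x; rewrite !inE => /andP[-> /exists_inP[q qt qx]].
  by apply/exists_inP; exists q => //; apply: tt'.
have ocP (T' : finType) (r : rel T') (X : {set T'}) : set0 \in order_complex r X.
  by have [] := order_complex_simplicial r X.
apply: (@acyclic_transfer _ _ _ (order_complex le' Q)
  (fun s => order_complex le' (up s)) (fun t => order_complex le (over t))
  (fun s => order_complex le (over (f @: s)))) => //.
- exact: order_complex_simplicial.
- exact: order_complex_simplicial.
- move=> s t _ /subsetP ts; apply: order_complexS; apply/subsetP => q.
  rewrite !inE => /andP[-> /exists_inP[x xt xq]].
  by apply/exists_inP; exists x => //; apply: ts.
- move=> s sP sn0; have [m ms mmin] := chain_min ler let_ sP sn0.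
  have [/subsetP sub _] := order_complexP _ _ _ sP.
  apply: (@order_complex_cone _ _ ler' _ (f m)).
    by rewrite inE fPQ ?sub //=; apply/exists_inP; exists m.
  move=> q; rewrite inE => /andP[_ /exists_inP[x xs]].
  by apply: let'; apply: fmono; rewrite ?sub ?mmin.
- move=> s _; split=> //; apply: order_complexS.
  by apply/subsetP => q; rewrite inE => /andP[].
- by move=> s t _ ts; apply: order_complexS; apply: overS.
- move=> s _; split=> //; apply: order_complexS.
  by apply/subsetP => q; rewrite inE => /andP[].
- by move=> s t _ ts; apply: order_complexS; apply: overS; apply: imsetS.
- move=> s sP sn0; apply: over_acyclic; first exact: im_chain.
  by case/set0Pn: sn0 => x xs; apply/set0Pn; exists (f x); apply: imset_f.
- move=> s sP; have [/subsetP sub cmp] := order_complexP _ _ _ sP.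
  split; last by apply: order_complexS; apply/subsetP => q; rewrite inE => /andP[].
  apply/order_complexP; split=> //; apply/subsetP => x xs; rewrite inE sub //=.
  by apply/exists_inP; exists (f x) => //; apply: imset_f.
- move=> s t _ /order_complexP[/subsetP tup _]; apply: order_complexS.
  apply/subsetP => x; rewrite !inE => /andP[-> /exists_inP[q /tup]].
  rewrite inE => /andP[_ /exists_inP[y ys yq] qx].
  by apply/exists_inP; exists (f y); [apply: imset_f|apply: let' qx].
Qed.

(** * Fillings in joins *)
Section Joins.
Variable V : finType.
Implicit Types (B X Y Z : {set {set V}}) (U W s t : {set V}).

Lemma points_simplicial U : simplicial_complex (points U).
Proof.
split; first exact: setU11.
move=> s t /setU1P[->|/imsetP[u uU ->]].
  by rewrite subset0 => /eqP->; apply: setU11.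
rewrite subset1 => /orP[/eqP->|/eqP->]; last exact: setU11.
by apply/setU1P; right; apply: imset_f.
Qed.

Lemma join_simplicial X Y :
  simplicial_complex X -> simplicial_complex Y -> simplicial_complex (join X Y).
Proof.
move=> [X0 Xd] [Y0 Yd]; split.
  by apply/imset2P; exists set0 set0 => //; rewrite setU0.
move=> _ t /imset2P[a b aX bY ->] tab; apply/imset2P.
exists (t :&: a) (t :&: b).
- by apply: Xd aX _; apply: subsetIr.
- by apply: Yd bY _; apply: subsetIr.
by rewrite -setIUr; apply/esym/setIidPl.
Qed.

Lemma joinA X Y Z : join X (join Y Z) = join (join X Y) Z.
Proof.
apply/setP => s; apply/imset2P/imset2P.
  case=> a _ aX /imset2P[b c bY cZ ->] ->; exists (a :|: b) c => //; last by rewrite setUA.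
  by apply/imset2P; exists a b.
case=> _ c /imset2P[a b aX bY ->] cZ ->; exists a (b :|: c) => //; last by rewrite setUA.
by apply/imset2P; exists b c.
Qed.

Lemma join_set0 X : join X [set set0] = X.
Proof.
apply/setP => s; apply/imset2P/idP => [[a b aX /set1P-> ->]|sX]; first by rewrite setU0.
by exists s set0; rewrite ?inE // setU0.
Qed.

Lemma join_0set X : join [set set0] X = X.
Proof.
apply/setP => s; apply/imset2P/idP => [[a b /set1P-> bX ->]|sX]; first by rewrite set0U.
by exists set0 s; rewrite ?inE // set0U.
Qed.

Lemma joinUr X Y Z : join X (Y :|: Z) = join X Y :|: join X Z.
Proof.
apply/setP => s; rewrite inE; apply/imset2P/orP.
  by case=> a b aX /setUP[bY|bZ] ->; [left|right]; apply/imset2P; exists a b.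
by case=> /imset2P[a b aX bY ->]; exists a b; rewrite // inE bY ?orbT.
Qed.

Lemma sub_join X Y : set0 \in Y -> X \subset join X Y.
Proof.
by move=> Y0; apply/subsetP => s sX; apply/imset2P; exists s set0; rewrite ?setU0.
Qed.

Lemma points_sub_powerset U W : U \subset W -> points U \subset powerset W.
Proof.
move=> /subsetP UW; apply/subsetP => s /setU1P[->|/imsetP[u uU ->]].
  by rewrite inE sub0set.
by rewrite inE sub1set UW.
Qed.

Lemma join_sub_powerset X Y W :
  X \subset powerset W -> Y \subset powerset W -> join X Y \subset powerset W.
Proof.
move=> /subsetP XW /subsetP YW; apply/subsetP => _ /imset2P[a b /XW + /YW + ->].
by rewrite !inE subUset => -> ->.
Qed.

(** Joining with one point gives a cone.  Each further point of [U] adds another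
    cone over [B], glued along [B], so that only the fillings of [B] one degree
    lower matter. *)
Lemma fillable_join_points B U m :
  simplicial_complex B -> B \subset powerset (~: U) -> U != set0 ->
  (forall n, n < m -> fillable B n) ->
  forall n, n < m.+1 -> fillable (join B (points U)) n.
Proof.
move=> cB BU Un0 fB; have [B0 Bd] := cB.
have cone u n : fillable (join B (points [set u])) n.
  apply: (@acyclic_cone _ _ u) => _ /imset2P[a b aB bu ->]; apply/imset2P.
  exists a [set u] => //; first by apply/setU1P; right; apply: imset_f; apply: set11.
  case/setU1P: bu => [->|/imsetP[v /set1P-> ->]]; first by rewrite setU0 setUC.
  by rewrite setUCA setUid.
elim: {U}#|U| {-2}U (erefl #|U|) BU Un0 => [|k IH] U cU BU Un0 n nm.
  by rewrite (cards0_eq cU) eqxx in Un0.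
have [u uU] := set0Pn _ Un0.
have -> : points U = points (U :\ u) :|: points [set u].
  apply/setP => s; rewrite -{1}(setD1K uU) /points imsetU !imset_set1 !inE.
  by case: (s == set0); case: (s == [set u]); rewrite ?orbT ?orbF.
have [U0|U'n0] := eqVneq (U :\ u) set0.
  rewrite U0 (_ : _ :|: _ = points [set u]) //.
  by apply/setUidPr; rewrite /points imset0 setU0; apply: subsetUl.
have BU' : B \subset powerset (~: (U :\ u)).
  by apply: subset_trans BU _; rewrite powersetS setCS subD1set.
rewrite joinUr; apply: fillable_union; rewrite ?cone //.
- by apply: join_simplicial => //; apply: points_simplicial.
- by apply: join_simplicial => //; apply: points_simplicial.
- by apply: IH => //; move: cU; rewrite (cardsD1 u) uU => -[].
move=> n0; rewrite (_ : _ :&: _ = B); first by apply: fB; case: n n0 nm.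
apply/eqP; rewrite eqEsubset; apply/andP; split; last first.
  by rewrite subsetI !sub_join ?setU11.
apply/subsetP => s /setIP[/imset2P[a b aB bU ->]] /imset2P[a' b' a'B b'u e].
have uab : u \notin a :|: b.
  rewrite inE negb_or; apply/andP; split.
    by have := subsetP BU a aB; rewrite inE => /subsetP/(_ u) h; apply/negP => /h; rewrite inE uU.
  case/setU1P: bU => [->|/imsetP[v /setD1P[vu _] ->]]; first by rewrite inE.
  by rewrite inE eq_sym.
move: e uab; case/setU1P: b'u => [->|/imsetP[v /set1P-> ->]] ->; first by rewrite setU0.
by rewrite !inE eqxx orbT.
Qed.

Lemma fillable_join_bigjoin (I : eqType) (r : seq I) (U : I -> {set V}) B m :
  uniq r -> {in r &, forall i j, i != j -> [disjoint U i & U j]} ->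
  {in r, forall i, U i != set0} ->
  simplicial_complex B -> {in r, forall i, B \subset powerset (~: U i)} ->
  (forall n, n < m -> fillable B n) ->
  forall n, n < m + size r ->
    fillable (join B (\big[@join V / [set set0]]_(i <- r) points (U i))) n.
Proof.
elim: r B m => [|i r IH] B m /=.
  by move=> _ _ _ _ _ fB n; rewrite addn0 big_nil join_set0; apply: fB.
move=> /andP[ir ur] dis Un0 cB BU fB n; rewrite addnS -addSn big_cons joinA.
have inr j : j \in r -> j \in i :: r by rewrite inE orbC => ->.
apply: IH => //.
- by move=> j k /inr jr /inr; apply: dis.
- by move=> j /inr; apply: Un0.
- by apply: join_simplicial => //; apply: points_simplicial.
- move=> j jr; apply: join_sub_powerset; first exact: BU (inr _ jr).
  apply: points_sub_powerset; rewrite -disjoints_subset; apply: dis (inr _ jr) _.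
    exact: mem_head.
  by apply: contraNneq ir => ->.
- by apply: fillable_join_points => //; [apply: BU|apply: Un0]; apply: mem_head.
Qed.

Lemma bigjoin_simplicial (I : Type) (r : seq I) (U : I -> {set V}) :
  simplicial_complex (\big[@join V / [set set0]]_(i <- r) points (U i)).
Proof.
elim: r => [|i r IH]; last first.
  by rewrite big_cons; apply: join_simplicial => //; apply: points_simplicial.
rewrite big_nil; split; first by rewrite inE.
by move=> s t /set1P->; rewrite subset0 inE.
Qed.

Lemma bigjoinS (I : eqType) (r : seq I) (U U' : I -> {set V}) :
  {in r, forall i, U i \subset U' i} ->
  \big[@join V / [set set0]]_(i <- r) points (U i) \subset
  \big[@join V / [set set0]]_(i <- r) points (U' i).
Proof.
elim: r => [|i r IH] h; first by rewrite !big_nil.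
rewrite !big_cons; apply: imset2S; last first.
  by apply: IH => j jr; apply: h; rewrite inE jr orbT.
by apply: setUS; apply: imsetS; apply: h; apply: mem_head.
Qed.

Lemma bigjoin_sub_powerset (I : eqType) (r : seq I) (U : I -> {set V}) W :
  {in r, forall i, U i \subset W} ->
  \big[@join V / [set set0]]_(i <- r) points (U i) \subset powerset W.
Proof.
elim: r => [|i r IH] h; first by rewrite big_nil sub1set inE sub0set.
rewrite big_cons; apply: join_sub_powerset.
  by apply: points_sub_powerset; apply: h; apply: mem_head.
by apply: IH => j jr; apply: h; rewrite inE jr orbT.
Qed.

Local Open Scope ring_scope.

(** In degree 1 a cycle is a set of vertices of even size, and the paths from its
    vertices to a base vertex fill it. *)
Lemma connected_fillable X n : simplicial_complex X -> connected_complex X ->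
  (n < 2)%N -> fillable X n.
Proof.
move=> [X0 Xd] [/set0Pn[v0 v0X] conn]; rewrite inE in v0X.
have size1 (v : V) : #|[set v]| = 1%N by rewrite cards1.
have path_fill v : [set v] \in X -> exists2 y : chain V, chain_in X 2 y &
    boundary y = simplex_chain [set v0] + simplex_chain [set v].
  move=> vX; have /connectP[p pp ->] : connect (fun x y => [set x; y] \in X) v0 v.
    by apply: conn; rewrite inE.
  elim/last_ind: p pp => [|p w IH] /=.
    by exists 0; [apply: chain_in0|rewrite boundary0 chain_addrr].
  rewrite rcons_path last_rcons => /andP[/IH[y yin yb]].
  set u := last v0 p => uw.
  have [<-|uw'] := eqVneq u w; first by exists y.
  exists (y + simplex_chain [set u; w]).
    apply: chain_inD => //; have := chain_in_simplex uw.
    by rewrite cards2 uw'.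
  rewrite boundaryD yb boundary_simplex /face_sum big_setU1 ?inE // big_set1 /=.
  rewrite [in X in _ + (X + _)]setU1K ?inE // setUC setU1K ?inE 1?eq_sym //.
  by rewrite -/u addrACA chain_addrr addr0.
case: n => [|[|//]] _ z zin bz.
  exists ([ffun t : {set V} => z set0 * (t == [set v0])%:R]).
    move=> t; rewrite ffunE; have [->|_] := eqVneq t [set v0]; last by rewrite mulr0 eqxx.
    by rewrite size1.
  apply/ffunP => t; rewrite ffunE.
  have [->|tn0] := eqVneq t set0; last first.
    have -> : z t = 0.
      by apply/eqP; apply: contraNT tn0 => /zin[_ /eqP]; rewrite cards_eq0.
    rewrite big1 // => x xt; rewrite ffunE; case: eqP => e; last by rewrite mulr0.
    have := size1 v0; rewrite -e cardsU1 xt => -[/eqP].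
    by rewrite cards_eq0 (negPf tn0).
  rewrite (bigD1 v0) ?inE //= ffunE setU0 eqxx mulr1 big1 ?addr0 // => x /andP[_ xv].
  by rewrite ffunE setU0 (inj_eq set1_inj) (negPf xv) mulr0.
have zE : z = \sum_(v | [set v] \in X) [ffun t : {set V} => z [set v] * (t == [set v])%:R].
  apply/ffunP => t; rewrite sum_ffunE.
  have [zt0|/[dup] zt /zin[tX /eqP/cards1P[v tE]]] := eqVneq (z t) 0.
    rewrite zt0 big1 // => v _; rewrite ffunE; case: eqP => [<-|_]; last by rewrite mulr0.
    by rewrite zt0 mul0r.
  rewrite (bigD1 v) /=; last by rewrite -tE.
  rewrite ffunE -tE eqxx mulr1 big1 ?addr0 // => w /andP[_ wv].
  by rewrite ffunE tE (inj_eq set1_inj) eq_sym (negPf wv) mulr0.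
have sz : \sum_(v | [set v] \in X) z [set v] = 0.
  transitivity (boundary z set0); last by rewrite bz ffunE.
  rewrite ffunE [LHS]big_mkcond [RHS]big_mkcond.
  apply: eq_bigr => v _; rewrite inE setU0 /=.
  by case: ifP => // /negP nX; apply/esym/eqP; apply/negPn/negP => /zin[].
have [y hy] : exists y : V -> chain V, forall v, [set v] \in X ->
    chain_in X 2 (y v) /\ boundary (y v) = simplex_chain [set v0] + simplex_chain [set v].
  apply: (@fin_all_exists _ (fun=> chain V) (fun v y => [set v] \in X ->
    chain_in X 2 y /\ boundary y = simplex_chain [set v0] + simplex_chain [set v])) => v.
  have [/path_fill[y yin yb]|nX] := boolP ([set v] \in X); first by exists y.
  by exists 0.
(* The path from the base vertex to [v], if [v] occurs in the cycle. *)
pose p v := [ffun t : {set V} => z [set v] * y v t] : chain V.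
exists (\sum_(v | [set v] \in X) p v).
  apply: chain_in_sum => v /hy[yin _] t; rewrite ffunE mulf_eq0 negb_or => /andP[_].
  exact: yin.
rewrite boundary_sum [RHS]zE; apply/ffunP => t; rewrite !sum_ffunE.
transitivity (\sum_(v | [set v] \in X) (z [set v] * (t == [set v0])%:R +
    z [set v] * (t == [set v])%:R)).
  apply: eq_bigr => v /hy[_ /ffunP/(_ t)]; rewrite !ffunE -mulrDr => <-.
  by rewrite mulr_sumr; apply: eq_bigr => x _; rewrite ffunE.
rewrite big_split /= -mulr_suml sz mul0r add0r.
by apply: eq_bigr => v _; rewrite ffunE.
Qed.

End Joins.

(** * Posets of covectors *)
Section OrientedMatroidTopology.
Variable E : finType.
Implicit Types (O : oriented_matroid E) (Phi Psi Theta : signvec E) (e w : E).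
Implicit Types (A U W : {set E}).

Lemma sv_leP Phi Psi : reflect (forall w, sign_le (Phi w) (Psi w)) (sv_le Phi Psi).
Proof. exact: forallP. Qed.

Lemma sv_le_refl : reflexive (@sv_le E).
Proof. by move=> Phi; apply/sv_leP => w; rewrite /sign_le eqxx orbT. Qed.

Lemma sv_le_trans : transitive (@sv_le E).
Proof.
move=> Psi Phi Xi /sv_leP h1 /sv_leP h2; apply/sv_leP => w.
move: (h1 w) (h2 w); rewrite /sign_le.
by case: (Phi w) => //; case: (Psi w) => //; case: (Xi w).
Qed.

Lemma sv_zero_le Phi : sv_le (sv_zero E) Phi.
Proof. by apply/sv_leP => w; rewrite ffunE. Qed.

Lemma sv_le_zero Phi : sv_le Phi (sv_zero E) -> Phi = sv_zero E.
Proof.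
move=> /sv_leP h; apply/ffunP => w; move: (h w); rewrite ffunE /sign_le.
by case: (Phi w).
Qed.

Lemma sv_le_pos Phi Psi : sv_le Phi Psi -> sv_pos Phi \subset sv_pos Psi.
Proof.
move=> /sv_leP h; apply/subsetP => w; move: (h w); rewrite !inE /sign_le.
by case: (Phi w) => //; case: (Psi w).
Qed.

Lemma nonzero_chain_size O s :
  s \in order_complex (@sv_le E) (covectors O) -> sv_zero E \notin s ->
  #|s| <= om_rank O.
Proof.
move=> /order_complexP[/subsetP sL cmp] s0.
rewrite /om_rank; case: ex_maxnP => k _; apply.
pose t := sort (@sv_le E) (enum s).
have tE : t =i s by move=> x; rewrite mem_sort mem_enum.
have tsz : size t == #|s| by rewrite size_sort -cardE.
apply/existsP; exists (Tuple tsz); apply/andP; split.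
  by apply/allP => x /=; rewrite tE => /sL.
have ut : uniq t by rewrite sort_uniq enum_uniq.
have srt : sorted (@sv_le E) t.
  apply: (@sort_sorted_in _ (mem s)); first by move=> x y xs ys; apply: cmp.
  by apply/allP => x; rewrite mem_enum.
have pw : pairwise (@sv_lt E) t.
  rewrite (pairwise_relI (fun x y => x != y) (@sv_le E)) -uniq_pairwise ut /=.
  by rewrite -sorted_pairwise //; apply: sv_le_trans.
rewrite /= path_sortedE; last exact: sv_lt_trans.
rewrite sorted_pairwise ?pw ?andbT; last exact: sv_lt_trans.
apply/allP => x; rewrite tE => xs; rewrite /sv_lt sv_zero_le andbT.
by apply: contraNneq s0 => ->.
Qed.

(** Deleting [e] keeps the ground set and turns [e] into a loop. *)
Definition sv_kill e Phi : signvec E := [ffun w => if w == e then Zero else Phi w].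

Lemma sv_oppK Phi : sv_opp (sv_opp Phi) = Phi.
Proof. by apply/ffunP => w; rewrite !ffunE; case: (Phi w). Qed.

Lemma mem_sv_sep Phi Psi w : (w \in sv_sep Phi Psi) =
  (Phi w == Pos) && (Psi w == Neg) || (Phi w == Neg) && (Psi w == Pos).
Proof. by rewrite !inE. Qed.

Definition deletion_covectors O e : {set signvec E} := sv_kill e @: covectors O.

Section DeletionAxioms.
Variables (O : oriented_matroid E) (e : E).

Lemma deletion_covector0 : sv_zero E \in deletion_covectors O e.
Proof.
apply/imsetP; exists (sv_zero E); first exact: covector0.
by apply/ffunP => w; rewrite !ffunE if_same.
Qed.

Lemma deletion_covectorN Phi :
  sv_opp Phi \in deletion_covectors O e <-> Phi \in deletion_covectors O e.
Proof.
suff H Psi : Psi \in deletion_covectors O e -> sv_opp Psi \in deletion_covectors O e.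
  by split=> [/H|/H //]; rewrite sv_oppK.
move=> /imsetP[Xi XL ->]; apply/imsetP; exists (sv_opp Xi); first exact/covectorN.
by apply/ffunP => w; rewrite !ffunE; case: ifP.
Qed.

Lemma deletion_covector_comp Phi Psi :
  Phi \in deletion_covectors O e -> Psi \in deletion_covectors O e ->
  sv_comp Phi Psi \in deletion_covectors O e.
Proof.
move=> /imsetP[P PL ->] /imsetP[Q QL ->]; apply/imsetP.
exists (sv_comp P Q); first exact: covector_comp.
by apply/ffunP => w; rewrite !ffunE; case: (w == e).
Qed.

Lemma deletion_covector_elim Pi Xi v :
  Pi \in deletion_covectors O e -> Xi \in deletion_covectors O e ->
  v \in sv_pos Pi :&: sv_neg Xi ->
  exists Theta, [/\ Theta \in deletion_covectors O e, Theta v = Zero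
    & forall w, w \notin sv_sep Pi Xi -> Theta w = sv_comp Pi Xi w].
Proof.
move=> /imsetP[P PL ->] /imsetP[X XL ->]; rewrite !inE !ffunE.
case: ifP => // ve vPX.
have [|T [TL Tv Tw]] := @covector_elim _ O P X v PL XL; first by rewrite !inE.
exists (sv_kill e T); split; first exact: imset_f.
  by rewrite ffunE ve.
move=> w; rewrite mem_sv_sep !ffunE; case: ifP => // we.
by move=> h; rewrite Tw ?mem_sv_sep // ffunE.
Qed.

Definition deletion : oriented_matroid E :=
  OrientedMatroid deletion_covector0 deletion_covectorN
    deletion_covector_comp deletion_covector_elim.

End DeletionAxioms.

(** Elimination at [e] between two covectors that differ at most at [e]. *)
Lemma kill_covector O e Phi Psi : Phi \in covectors O -> Psi \in covectors O ->
  Phi e = sign_opp (Psi e) -> (forall w, w != e -> Phi w = Psi w) ->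
  sv_kill e Phi \in covectors O.
Proof.
have key (P X : signvec E) : P \in covectors O -> X \in covectors O ->
    P e = Pos -> X e = Neg -> (forall w, w != e -> P w = X w) ->
    sv_kill e P \in covectors O.
  move=> PL XL Pe Xe PX.
  have [|T [TL Te Tw]] := @covector_elim _ O P X e PL XL; first by rewrite !inE Pe Xe.
  suff -> : sv_kill e P = T by [].
  apply/ffunP => w; rewrite ffunE; have [->|we] := eqVneq w e; first by rewrite Te.
  rewrite Tw ?ffunE ?mem_sv_sep -?PX //; first by case: eqP => // ->.
  by case: (P w).
move=> PL XL Pe PX; case Xe : (Psi e) => //; move: Pe; rewrite Xe /= => Pe.
- exact: (key Phi Psi).
- suff -> : sv_kill e Phi = Phi by [].
  by apply/ffunP => w; rewrite ffunE; case: eqP => // ->.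
rewrite (_ : sv_kill e Phi = sv_kill e Psi); first by apply: (key Psi Phi) => // w /PX.
by apply/ffunP => w; rewrite !ffunE; case: ifP => // /negbT /PX.
Qed.

(** Let [Phi0] be a covector over [Theta].  If it vanishes at [e] it is the
    minimum of the fiber.  Otherwise retract the fiber in two monotone steps:
    covectors with the sign opposite to [Phi0 e] at [e] go down to the value
    zero there, which elimination against [sv_comp Phi0 _] permits; then
    composing with [Phi0] moves up to the covectors that agree with [Phi0] at
    [e], and these have minimum [Phi0].  Each retraction is an instance of
    [quillen_fiber] whose fibers are cones. *)
Lemma deletion_fiber_acyclic O e Theta : Theta \in covectors (deletion O e) ->
  acyclic (order_complex (@sv_le E) [set Phi in covectors O | sv_le Theta (sv_kill e Phi)]).
Proof.
move=> /imsetP[Phi0 P0L ThE].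
set F := [set _ in _ | _].
have FP Phi : reflect (Phi \in covectors O /\ forall w, w != e -> sign_le (Phi0 w) (Phi w))
    (Phi \in F).
  rewrite inE ThE; apply: (iffP andP) => -[-> h]; split=> //.
    by move=> w we; move/sv_leP/(_ w): h; rewrite !ffunE (negPf we).
  by apply/sv_leP => w; rewrite !ffunE; case: ifP => // /negbT /h.
have P0F : Phi0 \in F by apply/FP; split=> // w _; rewrite /sign_le eqxx orbT.
have [x0Z|x0nZ] := eqVneq (Phi0 e) Zero.
  apply: (order_complex_cone sv_le_refl P0F) => Phi /FP[_ h]; apply/sv_leP => w.
  by have [->|/h//] := eqVneq w e; rewrite x0Z.
pose Q := [set Phi in F | Phi e != sign_opp (Phi0 e)].
pose R := [set Phi in F | Phi e == Phi0 e].
have leR Phi : Phi \in R -> sv_le Phi0 Phi.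
  rewrite inE => /andP[/FP[_ h] /eqP pe]; apply/sv_leP => w.
  by have [->|/h//] := eqVneq w e; rewrite pe /sign_le eqxx orbT.
have RQ Phi : Phi \in R -> Phi \in Q.
  by rewrite inE => /andP[PF /eqP pe]; rewrite inE PF pe; move: x0nZ; case: (Phi0 e).
have Rac : acyclic (order_complex (@sv_le E) R).
  by apply: (order_complex_cone sv_le_refl (a := Phi0)) => //; rewrite inE P0F /=.
have Qac : acyclic (order_complex (@sv_le E) Q).
  (* Composing with [Phi0] goes up, so the fiber lemma applies to the reverse order. *)
  rewrite -order_complex_opp; rewrite -order_complex_opp in Rac.
  have ge_refl : reflexive (fun x y => @sv_le E y x) by move=> x; apply: sv_le_refl.
  have ge_trans : transitive (fun x y => @sv_le E y x).
    by move=> y x z xy yz; apply: sv_le_trans yz xy.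
  apply: (quillen_fiber (f := sv_comp Phi0) ge_refl ge_trans ge_refl ge_trans _ _ _ Rac).
  - move=> x y _ _ /sv_leP h; apply/sv_leP => w; rewrite !ffunE; case: ifP => // _.
    by rewrite /sign_le eqxx orbT.
  - move=> x; rewrite inE => /andP[/FP[xL xle] _]; rewrite inE; apply/andP; split.
      apply/FP; split; first exact: covector_comp.
      by move=> w we; rewrite ffunE /sign_le; case: eqP => //=; rewrite eqxx.
    by rewrite ffunE x0nZ.
  move=> q qR; apply: (order_complex_cone ge_refl (a := q)).
    rewrite inE (RQ q qR) /=; apply/sv_leP => w; move/leR/sv_leP/(_ w): qR.
    by rewrite ffunE /sign_le; case: (Phi0 w); case: (q w).
  move=> x; rewrite inE => /andP[]; rewrite inE => /andP[/FP[_ xle] xe] /=.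
  apply: sv_le_trans; apply/sv_leP => w; rewrite ffunE.
  have [->|/xle] := eqVneq w e; move: x0nZ xe; rewrite /sign_le.
    by case: (Phi0 e) => // _; case: (x e).
  by move=> _ _; case: (Phi0 w); case: (x w).
pose g Phi := if Phi e == sign_opp (Phi0 e) then sv_kill e Phi else Phi.
have gle Phi : sv_le (g Phi) Phi.
  apply/sv_leP => w; rewrite /g; case: ifP => _; last by rewrite /sign_le eqxx orbT.
  by rewrite ffunE /sign_le; case: ifP; rewrite ?eqxx ?orbT.
apply: (quillen_fiber (f := g) sv_le_refl sv_le_trans sv_le_refl sv_le_trans _ _ _ Qac).
- move=> x y _ _ /sv_leP h; apply/sv_leP => w; move: (h w) (h e); rewrite /g /sign_le.
  case: (eqVneq (x e) (sign_opp _)) => xe;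
    case: (eqVneq (y e) (sign_opp _)) => ye //; rewrite ?ffunE.
  + by case: (w == e).
  + by case: (w == e).
  case: (eqVneq w e) => [->|_ //] _.
  by move: xe x0nZ; rewrite ye; case: (x e) => //; case: (Phi0 e).
- move=> x /[dup] xF /FP[xL xle]; rewrite inE /g; case: eqP => xe; last by rewrite xF; apply/eqP.
  apply/andP; split; last by rewrite ffunE eqxx; move: x0nZ; case: (Phi0 e).
  apply/FP; split; last by move=> w we; rewrite ffunE (negPf we); apply: xle.
  apply: (@kill_covector _ _ _ (sv_comp Phi0 x)) => //; first exact: covector_comp.
    by rewrite ffunE x0nZ.
  by move=> w /xle; rewrite ffunE /sign_le; case: (Phi0 w) => //= /eqP->.
move=> q; rewrite inE => /andP[qF qe].
apply: (order_complex_cone sv_le_refl (a := q)).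
  by rewrite inE qF /g (negPf qe) /= sv_le_refl.
by move=> x; rewrite inE => /andP[_ h]; apply: sv_le_trans h (gle x).
Qed.

Definition positive_cell O A : {set signvec E} :=
  [set Phi in covectors O | A \subset sv_pos Phi].

(** Delete the elements outside [A] one by one: by [deletion_fiber_acyclic] this
    preserves acyclicity, and in the end a single covector is left. *)
Lemma positive_cell_acyclic O A : positive_cell O A != set0 ->
  acyclic (order_complex (@sv_le E) (positive_cell O A)).
Proof.
(* The elements that remain to be deleted. *)
pose free O' := [set e | (e \notin A) && [exists Phi in covectors O', Phi e != Zero]].
elim: {O}#|free O| {-2}O (leqnn #|free O|) => [|k IH] O cO cell0.
  have [Phi0 P0] := set0Pn _ cell0.
  apply: (order_complex_cone sv_le_refl P0) => Phi; move: P0; rewrite !inE.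
  move=> /andP[P0L /subsetP P0A] /andP[_ /subsetP PA]; apply/sv_leP => e.
  have [eA|neA] := boolP (e \in A).
    by move: (P0A e eA) (PA e eA); rewrite !inE => /eqP-> /eqP->.
  have : e \notin free O by move: cO; rewrite leqn0 cards_eq0 => /eqP->; rewrite inE.
  by rewrite inE neA /= => /exists_inPn/(_ Phi0 P0L); rewrite negbK => /eqP->.
have [f0|/set0Pn[e]] := eqVneq (free O) set0; first by apply: IH => //; rewrite f0 cards0.
move=> efree; have neA : e \notin A by move: efree; rewrite inE => /andP[].
have sub Phi : (A \subset sv_pos (sv_kill e Phi)) = (A \subset sv_pos Phi).
  apply/subsetP/subsetP => h w /[dup] wA /h; rewrite !inE ffunE; case: (eqVneq w e) => // we.
  by rewrite -we wA in neA.
have mapP Phi : Phi \in positive_cell O A -> sv_kill e Phi \in positive_cell (deletion O e) A.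
  by rewrite !inE => /andP[PL PA]; rewrite sub PA andbT; apply: imset_f.
apply: (quillen_fiber (f := sv_kill e) (Q := positive_cell (deletion O e) A)
  sv_le_refl sv_le_trans sv_le_refl sv_le_trans) => //.
- move=> x y _ _ /sv_leP h; apply/sv_leP => w; rewrite !ffunE; case: ifP => //.
- move=> Th; rewrite inE => /andP[ThL ThA].
  rewrite (_ : [set _ in _ | _] = [set Phi in covectors O | sv_le Th (sv_kill e Phi)]).
    exact: deletion_fiber_acyclic.
  apply/setP => Phi; rewrite !inE -andbA; congr (_ && _).
  rewrite andb_idl // => /sv_le_pos; rewrite -sub; exact: subset_trans.
apply: IH; last first.
  by have [Phi0 P0] := set0Pn _ cell0; apply/set0Pn; exists (sv_kill e Phi0); apply: mapP.
rewrite -ltnS; apply: leq_trans cO; apply: proper_card; apply/properP; split.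
  apply/subsetP => w; rewrite !inE => /andP[-> /exists_inP[_ /imsetP[Phi PL ->]]].
  rewrite ffunE; case: ifP => // _ h; by apply/exists_inP; exists Phi.
exists e => //; rewrite inE neA /=; apply/exists_inPn => _ /imsetP[Phi PL ->].
by rewrite ffunE eqxx.
Qed.

Definition somewhere_positive O W A : {set signvec E} :=
  [set Phi in positive_cell O A | W :&: sv_pos Phi != set0].

(** Mayer-Vietoris along [W]: the condition is a union of cells indexed by [W], and
    intersecting with one of these cells only enlarges [A], which is why the
    statement carries [A]. *)
Lemma somewhere_positive_acyclic O W A : W != set0 ->
  positive_cell O (W :|: A) != set0 ->
  acyclic (order_complex (@sv_le E) (somewhere_positive O W A)).
Proof.
elim: {W}#|W| {-2}W (erefl #|W|) A => [|k IH] W cW A Wn0 cell.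
  by rewrite (cards0_eq cW) eqxx in Wn0.
have [e eW] := set0Pn _ Wn0.
have We := setD1K eW.
have -> : somewhere_positive O W A =
    positive_cell O (e |: A) :|: somewhere_positive O (W :\ e) A.
  apply/setP => Phi; rewrite !inE -{1}We setIUl setU_eq0 negb_and subUset sub1set.
  rewrite (_ : [set e] :&: _ != set0 = (e \in sv_pos Phi)).
    by rewrite inE; case: (_ \in covectors O); case: (_ \subset _); case: (_ == Pos).
  apply/set0Pn/idP => [[w /setIP[/set1P->]] //|h].
  by exists e; rewrite in_setI set11.
have up (X : {set E}) Phi Psi : X \subset sv_pos Phi -> sv_le Phi Psi -> X \subset sv_pos Psi.
  by move=> XP /sv_le_pos; apply: (subset_trans XP).
have cell' : positive_cell O (e |: A) != set0.
  have [Phi] := set0Pn _ cell; rewrite inE => /andP[PL PA]; apply/set0Pn; exists Phi.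
  by rewrite inE PL /=; apply: subset_trans PA; rewrite -We -setUA setUS // subsetUr.
rewrite order_complexU; first last.
- move=> Phi; rewrite inE => /andP[_ P0] Psi; rewrite in_setU => PsiPQ le.
  rewrite inE; apply/andP; split; last first.
    apply: contraNneq P0 => W0; rewrite -subset0 -W0; apply: setIS; exact: sv_le_pos.
  case/orP: PsiPQ; rewrite !inE => /andP[]; last by [].
  by rewrite subUset => -> /andP[].
- move=> Phi; rewrite inE => /andP[_ PA] Psi PsiPQ le; rewrite inE (up _ _ _ PA le) andbT.
  by move: PsiPQ; rewrite !inE => /orP[/andP[]//|/andP[/andP[]]].
- exact: sv_le_trans.
- exact: sv_le_refl.
have [W0|W'n0] := eqVneq (W :\ e) set0.
  rewrite (_ : somewhere_positive O (W :\ e) A = set0); last first.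
    by apply/setP => Phi; rewrite !inE W0 set0I eqxx andbF.
  rewrite (setUidPl _); first exact: positive_cell_acyclic.
  by apply: order_complexS; apply: sub0set.
have cW' : #|W :\ e| = k by move: cW; rewrite (cardsD1 e) eW => -[].
move=> n; apply: fillable_union.
- exact: order_complex_simplicial.
- exact: order_complex_simplicial.
- exact: positive_cell_acyclic.
- apply: IH => //; have [Phi] := set0Pn _ cell; rewrite inE => /andP[PL PA].
  apply/set0Pn; exists Phi; rewrite inE PL /=; apply: subset_trans PA.
  by apply: setSU; apply: subD1set.
move=> _; rewrite -order_complexI.
rewrite (_ : _ :&: _ = somewhere_positive O (W :\ e) (e |: A)).
  by apply: IH => //; rewrite setUCA setUA We.
apply/setP => Phi; rewrite !inE subUset; case: (_ \in covectors O) => //=.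
by case: (A \subset _); rewrite ?andbT ?andbF.
Qed.

(** A nonzero vector below a positive one is positive, so it suffices to minimize
    the positive part. *)
Lemma positive_vector_circuit O U Phi : is_vector O Phi -> sv_positive Phi ->
  sv_supp Phi \subset U -> contains_positive_circuit O U.
Proof.
move=> vP pP sP.
pose p C := [&& is_vector O C, sv_positive C & sv_supp C \subset U].
have pPhi : p Phi by apply/and3P.
case: (arg_minnP (fun C : signvec E => #|sv_pos C|) pPhi) => C /and3P[vC pC sC] Cmin.
apply/existsP; exists C; rewrite /is_circuit vC pC sC !andbT /=.
have [Cn0 /eqP Cneg] := andP pC.
rewrite Cn0; apply/forallP => Psi; apply/implyP => /andP[vPsi Pn0].
apply/negP => /andP[ne le]; have posS := sv_le_pos le.
have neg0 w : Psi w != Neg.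
  apply/negP => /eqP pw; move/sv_leP/(_ w): le; rewrite pw /sign_le /= => /eqP Cw.
  have : w \in sv_neg C by rewrite inE -Cw.
  by rewrite Cneg inE.
have neg0' : sv_neg Psi = set0.
  by apply/setP => w; rewrite !inE; apply/negbTE.
have pPsi : p Psi.
  apply/and3P; split=> //; first by rewrite /sv_positive Pn0 neg0' eqxx.
  apply: subset_trans sC; rewrite /sv_supp neg0' setU0; apply: subset_trans posS _.
  exact: subsetUl.
have /eqP posE : sv_pos Psi == sv_pos C by rewrite eqEcard posS Cmin.
case/eqP: ne; apply/ffunP => w; move/sv_leP/(_ w): (le); move: (neg0 w).
have := congr1 (fun X : {set E} => w \in X) posE; rewrite !inE /sign_le.
have : w \notin sv_neg C by rewrite Cneg inE.
rewrite inE.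
by case: (Psi w) => //; case: (C w).
Qed.

(** Take a covector [Y], nonnegative on [U], with positive part on [U] as large as
    possible, and let [W] be the rest of [U].  By maximality, seen on
    [sv_comp Y Z], a covector that is positive somewhere on [W] is also negative
    somewhere on [W].  So the indicator of [W] is orthogonal to all covectors:
    if [W] is nonempty it is a positive vector. *)
Lemma positive_covector O U : ~~ contains_positive_circuit O U ->
  positive_cell O U != set0.
Proof.
pose p Phi := (Phi \in covectors O) && [disjoint U & sv_neg Phi].
have p0 : p (sv_zero E).
  rewrite /p covector0; apply/pred0Pn => -[w /andP[_]] /=.
  by rewrite inE ffunE.
case: (arg_maxnP (fun Phi => #|U :&: sv_pos Phi|) p0) => Y /andP[YL Yneg] Ymax noC.
pose W := U :\: sv_pos Y.
have YW w : w \in W -> Y w = Zero.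
  rewrite inE => /andP[wp wU]; have := disjointFr Yneg wU; move: wp; rewrite !inE.
  by case: (Y w).
have WnegP Z : Z \in covectors O -> (exists2 w, w \in W & Z w = Pos) ->
    exists2 w, w \in W & Z w = Neg.
  move=> ZL [v vW Zv].
  pose T : {set E} := [set w in W | Z w == Neg].
  have [T0|/set0Pn[w]] := eqVneq T set0; last first.
    by rewrite inE => /andP[wW /eqP zw]; exists w.
  exfalso.
  have pYZ : p (sv_comp Y Z).
    rewrite /p covector_comp //=; apply/pred0Pn => -[w /andP[/= wU]].
    rewrite inE ffunE; have [Yw|Yw] := eqVneq (Y w) Zero.
      move=> Zw; have : w \in T by rewrite !inE Yw wU Zw.
      by rewrite T0 inE.
    by have := disjointFr Yneg wU; rewrite inE => ->.
  have := Ymax _ pYZ; rewrite /= leqNgt => /negP; apply; apply: proper_card.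
  apply/properP; split.
    apply/subsetP => w; rewrite !inE ffunE => /andP[-> /eqP->] //.
  exists v; last by rewrite !inE (YW v vW) andbF.
  by move: (vW); rewrite !inE ffunE (YW v vW) Zv => /andP[_ ->].
have WposP Z : Z \in covectors O -> (exists2 w, w \in W & Z w = Neg) ->
    exists2 w, w \in W & Z w = Pos.
  move=> ZL [v vW Zv]; have [||w wW] := WnegP (sv_opp Z).
  - exact/covectorN.
  - by exists v; rewrite // ffunE Zv.
  by rewrite ffunE => Zw; exists w => //; move: Zw; case: (Z w).
have [W0|Wn0] := eqVneq W set0.
  apply/set0Pn; exists Y; rewrite inE YL /=; move/eqP: W0; by rewrite setD_eq0.
pose C : signvec E := [ffun w => if w \in W then Pos else Zero].
case/negP: noC; apply: (@positive_vector_circuit _ _ C).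
- apply/forall_inP => Z ZL; rewrite /sv_orthogonal; apply/eqP; apply/existsP/existsP.
    case=> v; rewrite !ffunE; case: ifP; rewrite ?andbF // => vW /andP[/eqP Zv _].
    have [|w wW Zw] := WnegP Z ZL; first by exists v.
    by exists w; rewrite ffunE wW Zw.
  case=> v; rewrite !ffunE; case: ifP; rewrite ?andbF // => vW /andP[/eqP Zv _].
  have [|w wW Zw] := WposP Z ZL; first by exists v => //; move: Zv; case: (Z v).
  by exists w; rewrite ffunE wW Zw.
- rewrite /sv_positive; apply/andP; split.
    case/set0Pn: Wn0 => w wW; apply/eqP => /ffunP/(_ w); by rewrite !ffunE wW.
  by apply/eqP/setP => w; rewrite !inE ffunE; case: ifP.
apply/subsetP => w; rewrite !inE !ffunE; case: ifP => // + _.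
by rewrite inE => /andP[].
Qed.

Lemma positive_circuit_meets O U Phi : contains_positive_circuit O U ->
  Phi \in covectors O -> U :\: sv_pos Phi != set0.
Proof.
case/existsP => C /and3P[/and3P[/forall_inP vC _ _] /andP[Cn0 /eqP Cneg] /subsetP CU] PL.
apply/negP; rewrite setD_eq0 => /subsetP UP.
have [e Ce] : exists e, C e != Zero.
  apply/existsP; apply: contraNT Cn0 => /existsPn h; apply/eqP/ffunP => w.
  by rewrite ffunE; apply/eqP; rewrite -[_ == _]negbK.
have CPos w : C w != Zero -> C w = Pos /\ Phi w = Pos.
  move=> Cw; have Cp : C w = Pos.
    have : w \notin sv_neg C by rewrite Cneg inE.
    by move: Cw; rewrite inE; case: (C w).
  split=> //; have : w \in sv_pos Phi by apply/UP/CU; rewrite !inE Cp.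
  by rewrite inE => /eqP.
have := vC Phi PL; rewrite /sv_orthogonal => /eqP h.
have : [exists v, (C v == Phi v) && (C v != Zero)].
  by apply/existsP; exists e; have [-> ->] := CPos e Ce.
rewrite h => /existsP[w /andP[/eqP Cw Cw0]].
by have [Cp Pp] := CPos w Cw0; rewrite Cp Pp in Cw.
Qed.

End OrientedMatroidTopology.

(** * The trace contradiction *)
Section Contradiction.
Local Open Scope ring_scope.

(** [M] carries a chain map from the order complex of the covectors into [K] and
    avoids positive parts; positivity of the faces of [K] gives a chain map back.
    The trace of the composite would be 1 because of the empty simplex, and 0 by
    [cone_trace]. *)
Lemma no_avoiding_carrier (V : finType) (O : oriented_matroid V) (K : {set {set V}})
  (M : signvec V -> {set {set V}}) :
  simplicial_complex K ->
  {in K, forall s, s != set0 -> positive_cell O s != set0} ->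
  (forall Phi, simplicial_complex (M Phi)) ->
  (forall Phi, M Phi \subset K) ->
  M (sv_zero V) = K ->
  (forall Phi Psi, sv_le Phi Psi -> M Psi \subset M Phi) ->
  (forall Phi s, s \in M Phi -> s :&: sv_pos Phi = set0) ->
  (forall n, (n <= om_rank O)%N -> fillable K n) ->
  {in covectors O, forall Phi, Phi != sv_zero V ->
     forall n, (n < om_rank O)%N -> fillable (M Phi) n} ->
  False.
Proof.
move=> cK Kpos cM MK M0 Manti Mneg Kfill Mfill.
pose z := sv_zero V.
pose D := order_complex (@sv_le V) (covectors O).
have cD : simplicial_complex D := order_complex_simplicial _ _.
have [D0 Dd] := cD.
have zD s : s \in D -> z |: s \in D.
  move=> /order_complexP[/subsetP sL cmp]; apply/order_complexP; split.
    by apply/subsetP => x /setU1P[->|/sL //]; apply: covector0.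
  move=> x y /setU1P[->|xs] /setU1P[->|ys]; rewrite ?sv_zero_le ?orbT //.
  exact: cmp.
pose C (s : {set signvec V}) :=
  [set t : {set V} | (t == set0) || [exists Phi in s, t \in M Phi]].
have CK s : C s \subset K.
  apply/subsetP => t; rewrite inE => /orP[/eqP->|/exists_inP[Phi _]]; first by case: cK.
  exact: (subsetP (MK Phi)).
have Cmin (s : {set signvec V}) m : m \in s -> {in s, forall x, sv_le m x} -> C s = M m.
  move=> ms mmin; apply/setP => t; rewrite inE; apply/orP/idP => [[/eqP->|]|tM].
  - by case: (cM m).
  - by case/exists_inP => x /mmin /Manti/subsetP; apply.
  by right; apply/exists_inP; exists m.
have [|||psi hpsi] := @carrier_chain_map _ _ D C cD.
- move=> s t _ /subsetP ts; apply/subsetP => x; rewrite !inE => /orP[->//|].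
  by case/exists_inP => Phi /ts Ps xM; apply/orP; right; apply/exists_inP; exists Phi.
- by rewrite inE eqxx.
- move=> s sD sn0.
  have [m ms mmin] := chain_min (@sv_le_refl V) (@sv_le_trans V) sD sn0.
  rewrite (Cmin s m) //; have [mz|mz] := eqVneq m z.
    rewrite mz M0; apply: Kfill; rewrite (cardsD1 m) ms /= mz.
    by apply: nonzero_chain_size; [apply: Dd sD _; apply: subD1set|rewrite !inE eqxx].
  have mL : m \in covectors O.
    by have [/subsetP sL _] := order_complexP _ _ _ sD; apply: sL.
  apply: Mfill => //; rewrite prednK ?card_gt0 //; apply: nonzero_chain_size => //.
  by apply: contra mz => /mmin /sv_le_zero ->.
(* Larger faces are met by more covectors, so this carrier is monotone. *)
pose N (t : {set V}) := order_complex (@sv_le V) (somewhere_positive O t set0).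
have [|||eta heta] := @carrier_chain_map _ _ K N cK.
- move=> s t _ ts; apply: order_complexS; apply/subsetP => Phi.
  rewrite !inE => /andP[-> /=]; apply: contraNneq => s0.
  by rewrite -subset0 -s0; apply: setSI.
- by have [] := order_complex_simplicial (@sv_le V) (somewhere_positive O set0 set0).
- move=> s sK sn0; apply: somewhere_positive_acyclic => //.
  by rewrite setU0; apply: Kpos.
have ND t : N t \subset D.
  by apply: order_complexS; apply/subsetP => Phi; rewrite !inE => /andP[/andP[]].
pose theta s := linear_ext eta (psi s).
have thetaP s : s \in D ->
    chain_in D #|s| (theta s) /\ boundary (theta s) = face_sum theta s.
  move=> sD; have [pin pb] := proj2 hpsi s sD.
  have [h ->] := carried_linear_ext heta (CK s) (fun t _ => ND t) pin.
  by split=> //; rewrite pb linear_ext_sum.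
have diag s : s \in D -> s != set0 -> theta s s = 0.
  move=> sD sn0; rewrite ffunE big1 // => t _; apply/eqP.
  rewrite mulf_eq0; have [//|pst /=] := eqVneq (psi s t) 0.
  apply/negPn/negP => ets; have [pin _] := proj2 hpsi s sD.
  have [tC _] := pin t pst; have [ein _] := proj2 heta t (subsetP (CK s) t tC).
  have [/order_complexP[/subsetP sN _] _] := ein s ets.
  move: tC; rewrite inE => /orP[/eqP t0|/exists_inP[Phi Ps tM]].
    by have [Phi /sN] := set0Pn _ sn0; rewrite inE t0 set0I eqxx andbF.
  by have := sN Phi Ps; rewrite inE (Mneg _ _ tM) eqxx andbF.
have thetaD s t : s \in D -> theta s t != 0 -> t \in D.
  by move=> sD nz; have [] := proj1 (thetaP s sD) t nz.
have := cone_trace cD zD (fun s sD => proj2 (thetaP s sD)) thetaD.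
rewrite (bigD1 set0) //= big1 => [|s /andP[]]; last exact: diag.
rewrite addr0 /theta (proj1 hpsi) linear_ext_simplex (proj1 heta) ffunE eqxx.
by move/eqP; rewrite oner_eq0.
Qed.

End Contradiction.

(** * Colorful positive circuits *)

Theorem mainTheorem4 (V : finType) (d : nat) (O : oriented_matroid V)
  (hrank : om_rank O <= d)
  (r : nat) (hr : maxn d.+1 2 <= r)
  (U : nat -> {set V})
  (hdisj : forall i j, 1 <= i <= r -> 1 <= j <= r -> i != j ->
     [disjoint U i & U j])
  (hcirc : forall i, 1 <= i <= r -> contains_positive_circuit O (U i))
  (K12 : {set {set V}})
  (hK12 : simplicial_complex K12)
  (hK12sub : K12 \subset join (points (U 1)) (points (U 2)))
  (hK12conn : connected_complex K12)
  (hK12vert : vertex_set K12 = U 1 :|: U 2)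
  (K : {set {set V}})
  (hKcx : simplicial_complex K)
  (hK : K = join K12
              (\big[@join V / [set set0]]_(3 <= i < r.+1) points (U i))) :
  exists2 sigma : {set V}, sigma \in K & contains_positive_circuit O sigma.
Proof.
have [dr r2] : d < r /\ 1 < r by apply/andP; rewrite -geq_max.
apply/exists_inP; apply: contraT => /exists_inPn nocirc; exfalso.
pose idx := index_iota 3 r.+1.
have idxP i : i \in idx -> 1 <= i <= r /\ 2 < i.
  by rewrite mem_index_iota ltnS => /andP[i3 ->]; rewrite (ltn_trans _ i3).
have idx_size : size idx = r - 2 by rewrite size_iota subSS.
(* The zero covector carries all of [K]: a simplex with apex zero can have one
   vertex more than the rank, and then only [K] has the filling it needs. *)
pose M Phi := if Phi == sv_zero V then K else
  join (points (U 1 :\: sv_pos Phi))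
    (\big[@join V / [set set0]]_(i <- idx) points (U i :\: sv_pos Phi)).
have r1 : 1 <= 1 <= r by exact: ltnW r2.
have MK Phi : M Phi \subset K.
  rewrite /M; case: ifP => // _; rewrite hK; apply: imset2S; last first.
    by apply: bigjoinS => i _; apply: subsetDl.
  apply/subsetP => s /setU1P[->|/imsetP[u /setDP[uU _] ->]]; first by case: hK12.
  have : u \in vertex_set K12 by rewrite hK12vert inE uU.
  by rewrite inE.
apply: (@no_avoiding_carrier V O K M) => //.
- move=> s sK _; apply: positive_covector; exact: nocirc.
- move=> Phi; rewrite /M; case: ifP => // _; apply: join_simplicial.
    exact: points_simplicial.
  exact: bigjoin_simplicial.
- by rewrite /M eqxx.
- move=> Phi Psi le; rewrite {2}/M; case: ifP => [_|Phi0]; first exact: MK.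
  rewrite /M; case: eqP => [Psi0|_].
    by move: le Phi0; rewrite Psi0 => /sv_le_zero ->; rewrite eqxx.
  have sD i : U i :\: sv_pos Psi \subset U i :\: sv_pos Phi.
    by apply: setDS; apply: sv_le_pos.
  apply: imset2S; last exact: bigjoinS.
  by apply: setUS; apply: imsetS.
- move=> Phi s; rewrite /M; case: eqP => [-> _|_ sM].
    by apply/setP => w; rewrite !inE ffunE andbF.
  have sub i : U i :\: sv_pos Phi \subset ~: sv_pos Phi.
    by rewrite setDE; apply: subsetIr.
  have Ms := join_sub_powerset (points_sub_powerset (sub 1))
    (@bigjoin_sub_powerset _ _ idx _ _ (fun i _ => sub i)).
  by have := subsetP Ms s sM; rewrite inE -disjoints_subset -setI_eq0 => /eqP.
- move=> n nr; rewrite hK; apply: (@fillable_join_bigjoin _ _ _ _ _ 2) => //.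
  + exact: iota_uniq.
  + by move=> i j /idxP[ir _] /idxP[jr _]; apply: hdisj.
  + move=> i /idxP[ir _]; have := positive_circuit_meets (hcirc i ir) (covector0 O).
    by apply: contraNneq => ->; rewrite set0D.
  + move=> i /idxP[ir i2]; apply: subset_trans hK12sub _.
    by apply: join_sub_powerset; apply: points_sub_powerset; rewrite -disjoints_subset;
      apply: hdisj => //; rewrite ?r2 // neq_ltn ?i2 // (ltn_trans _ i2).
  + by move=> k; apply: connected_fillable.
  by rewrite idx_size subnKC //; apply: leq_ltn_trans nr (leq_ltn_trans hrank dr).
move=> Phi PL Phi0 n nr; rewrite /M (negPf Phi0).
have allr i : i \in 1 :: idx -> 1 <= i <= r.
  by rewrite inE => /predU1P[->//|/idxP[]].
have meets i : i \in 1 :: idx -> U i :\: sv_pos Phi != set0.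
  by move=> /allr ir; apply: positive_circuit_meets PL; apply: hcirc.
(* [U 1] is joined like the other colors, to the complex whose only face is
   empty; hence [m = 0]. *)
have := @fillable_join_bigjoin V _ (1 :: idx) (fun i => U i :\: sv_pos Phi)
  [set set0] 0.
rewrite big_cons join_0set; apply => //.
- rewrite /= iota_uniq andbT; apply/negP => /idxP[] //.
- move=> i j /allr ir /allr jr ij; apply: disjointWl (subsetDl _ _) _.
  by apply: disjointWr (subsetDl _ _) _; apply: hdisj.
- by split=> [|s t /set1P->]; rewrite ?subset0 inE.
- by move=> i _; rewrite sub1set inE sub0set.
rewrite /= idx_size add0n -subSn // subSS subn1.
by apply: leq_trans nr _; apply: leq_trans hrank _; rewrite -ltnS prednK // ltnW.
Qed.
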